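(* Let $m\ge2$ and let $(p:\mathcal P\to N,\omega)$ be a lightlike Cartan geometry with standard tractor bundle $\mathcal T\to N$, with its canonical metric $\mathbf h$ and canonical linear connection $\nabla^{\mathcal T}$. Then there exists a distinguished lightlike section $\xi\in\Gamma(\mathcal T)$ such that the following morphism of vector bundles over $N$, $$\Phi:=\nabla^{\mathcal T}\xi:TN\to\mathcal T,\qquad W\mapsto\nabla^{\mathcal T}_W\xi,$$ is a monomorphism and an isometry between $(T_xN,h^\omega_x)$ and $(\mathcal T_x,\mathbf h_x)$ for every $x\in N$ (that is, $\mathbf h_x(\Phi(v),\Phi(w))=h^\omega_x(v,w)$ for all $v,w\in T_xN$). Moreover, $\Phi(Z^\omega)=\xi$.
   Context: Conventions. Manifolds are smooth, Hausdorff, connected, second countable. $\mathbb L^{m+2}$ is $\mathbb R^{m+2}$ with the Lorentzian inner product $\langle v,v\rangle=v_1^2+\dots+v_{m+1}^2-v_{m+2}^2$; its future lightlike cone is the set of $v$ with $\langle v,v\rangle=0$ and $v_{m+2}>0$. Fix a basis $(\ell,e_1,\dots,e_m,n)$ with $\ell$ in the future lightlike cone, $\langle \ell,n\rangle=1$, $\langle e_i,e_j\rangle=\delta_{ij}$ and all other products of basis vectors zero. $G=O^+(m+1,1)$ is the group of linear isometries of $\mathbb L^{m+2}$ preserving the future lightlike cone, $H\subset G$ is the isotropy subgroup of $\ell$, and $\mathfrak h\subset\mathfrak g$ are their Lie algebras. In the fixed basis $\mathfrak g$ consists of the matrices $\begin{pmatrix} a&\zeta&0\\ X&A&-\zeta^t\\0&-X^t&-a\end{pmatrix}$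 with $a\in\mathbb R$, $X\in\mathbb R^m$, $\zeta\in(\mathbb R^m)^*$, $A\in\mathfrak o(m)$, and $\mathfrak h$ is given by $a=0$, $X=0$; so $\mathfrak g/\mathfrak h\cong\mathbb R\times\mathbb R^m$ via $(a,X)$. A lightlike Cartan geometry on an $(m+1)$-dimensional manifold $N$ is a principal bundle $p:\mathcal P\to N$ with structure group $H$ together with $\omega\in\Omega^1(\mathcal P,\mathfrak g)$ such that each $\omega(u):T_u\mathcal P\to\mathfrak g$ is a linear isomorphism, $(r^h)^*\omega=\mathrm{Ad}(h^{-1})\circ\omega$ for $h\in H$ (where $r^h$ is right translation by $h$), and $\omega(\zeta_X)=X$ for the fundamental vector field $\zeta_X$ of each $X\in\mathfrak h$. For $u\in\mathcal P$, $x=p(u)$, let $\phi_u:T_xN\to\mathfrak g/\mathfrak h$ be the isomorphism with $\phi_u(T_up\cdot\eta)=\omega(u)(\eta)+\mathfrak h$ for $\eta\in T_u\mathcal P$. With $q((a,X),(b,Y))=X^tY$ on $\mathbb R\times\mathbb R^m$, put $h^\omega_x(v,w)=q(\phi_u v,\phi_u w)$ and $Z^\omega_x=\phi_u^{-1}(1,0)$ (independent of the choice of $u$ over $x$): $h^\omega$ is a lightlike metric (positive semidefinite with one-dimensional radical) and $Z^\omega$ spans its radical. The standard tractor bundle is $\mathcal T=\mathcal P\times_H\mathbb L^{m+2}$ with the Lorentzian bundle metric $\mathbf h([u,v_1],[u,v_2])=\langle v_1,v_2\rangle$ and the $\mathbf h$-metric connection $\nabla^{\mathcal T}$ induced by the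 unique principal connection on $\mathcal P\times_HG$ whose pullback to $\mathcal P$ is $\omega$; locally $\nabla^{\mathcal T}_W[s,f]=[s,W(f)+\omega(Ts\cdot W)f]$ for a local section $s$ of $\mathcal P$ and an $\mathbb L^{m+2}$-valued function $f$. A section of $\mathcal T$ is lightlike if it is nowhere zero and $\mathbf h$ of it with itself vanishes. *)

(* Defs.v *)
From HB Require Import structures.
From mathcomp Require Import all_boot all_order all_algebra generic_quotient.
From mathcomp Require Import all_classical all_reals all_analysis.

Set Implicit Arguments.
Unset Strict Implicit.
Unset Printing Implicit Defensive.

Import Order.TTheory GRing.Theory Num.Theory.
Import numFieldNormedType.Exports.

Local Open Scope classical_set_scope.
Local Open Scope ring_scope.
Local Open Scope quotient_scope.

(* Only finite-dimensional model spaces E, F are used for manifolds: spaces of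
   row vectors, of matrices, and their products. For these, C^(k+1) means
   differentiable with all directional derivatives C^k. *)

Fixpoint Ck_on {R : realType} {E F : normedModType R} (k : nat) (U : set E)
    (f : E -> F) : Prop :=
  if k is k'.+1 then
    (forall x, U x -> differentiable f x) /\
    (forall v, Ck_on k' U (fun x => 'D_v f x))
  else forall x, U x -> {for x, continuous f}.

Definition Cinfty_on {R : realType} {E F : normedModType R} (U : set E)
  (f : E -> F) : Prop := forall k, Ck_on k U f.

(* [coord i] and [par i] are total functions; they are meaningful on [dom i]
   and on its image respectively. The axioms are in [is_manifold]. [chart_at]
   selects a preferred chart around each point, in which tangent vectors and
   local expressions of maps are written; by [mfd_compat] another selection
   gives equivalent notions. *)
Record charted {R : realType} (E : normedModType R) := Charted {
  carrier :> topologicalType;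
  chart : Type;
  dom : chart -> set carrier;
  coord : chart -> carrier -> E;
  par : chart -> E -> carrier;
  chart_at : carrier -> chart }.

Arguments coord {R E c} _ _.
Arguments par {R E c} _ _.
Arguments dom {R E c} _ _.
Arguments chart_at {R E c} _.

Record is_manifold {R : realType} {E : normedModType R} (M : charted E) : Prop
    := IsManifold {
  mfd_hausdorff : hausdorff_space M;
  mfd_second_countable : @second_countable M;
  mfd_cover : forall x : M, dom (chart_at x) x;
  mfd_dom_open : forall i : chart M, open (dom i);
  mfd_img_open : forall i : chart M, open (coord i @` dom i);
  mfd_coordK : forall (i : chart M) x, dom i x -> par i (coord i x) = x;
  mfd_coord_cont : forall (i : chart M) x,
    dom i x -> {for x, continuous (coord i)};
  mfd_par_cont : forall (i : chart M) x,
    dom i x -> {for coord i x, continuous (par i : E -> M)};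
  mfd_compat : forall i j : chart M,
    Cinfty_on (coord i @` (dom i `&` dom j)) (coord j \o par i : E -> E) }.

Definition vec {R : realType} (E : normedModType R) : charted E :=
  @Charted R E E unit (fun _ => setT) (fun _ => id) (fun _ => id) (fun _ => tt).

Definition prodc {R : realType} {E F : normedModType R}
    (M : charted E) (N : charted F) : charted (E * F)%type :=
  @Charted R (E * F)%type (M * N)%type (chart M * chart N)%type
    (fun ij => [set xy | dom ij.1 xy.1 /\ dom ij.2 xy.2])
    (fun ij xy => (coord ij.1 xy.1, coord ij.2 xy.2))
    (fun ij ab => (par ij.1 ab.1, par ij.2 ab.2))
    (fun xy => (chart_at xy.1, chart_at xy.2)).

(* The tangent space at x is the model space, a vector being identified with
   its components in the preferred chart at x. *)
Definition tangent {R : realType} {E : normedModType R} (M : charted E)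
  (x : M) : normedModType R := E.

Definition local_expr {R : realType} {E F : normedModType R}
    {M : charted E} {N : charted F} (f : M -> N) (x : M) : E -> F :=
  coord (chart_at (f x)) \o f \o par (chart_at x).

Definition tmap {R : realType} {E F : normedModType R}
    {M : charted E} {N : charted F} (f : M -> N) (x : M)
    (v : tangent x) : tangent (f x) :=
  'd (local_expr f x) (coord (chart_at x) x) v.

(* Smoothness on some neighbourhood of x. *)
Definition smooth_at {R : realType} {E F : normedModType R}
    {M : charted E} {N : charted F} (f : M -> N) (x : M) : Prop :=
  {for x, continuous f} /\
  exists W : set E, [/\ open W, W (coord (chart_at x) x)
    & Cinfty_on W (local_expr f x)].

(* Smoothness on an arbitrary subset A, by local smooth extension. When A is
   open, or U `*` H with H a closed matrix group, this is smoothness for the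
   submanifold structure of A. *)
Definition smooth_within {R : realType} {E F : normedModType R}
    {M : charted E} {N : charted F} (A : set M) (f : M -> N) : Prop :=
  forall x, A x -> exists g : M -> N,
    smooth_at g x /\ \forall y \near x, A y -> g y = f y.

(* The i-th coordinate frame: the field on [dom i] with constant components v
   in the chart i. *)
Definition coord_field {R : realType} {E : normedModType R} {M : charted E}
    (i : chart M) (v : E) (x : M) : tangent x :=
  'd (coord (chart_at x) \o par i) (coord i x) v.

Definition smooth_form {R : realType} {E V : normedModType R} {M : charted E}
    (w : forall x : M, tangent x -> V) : Prop :=
  forall (i : chart M) (v : E),
    Cinfty_on (coord i @` dom i) (fun z => w (par i z) (coord_field i v (par i z))).

Section LocalTrivialization.
Context {R : realType} {E F : normedModType R} {k : nat}.
Variables (H : set 'M[R]_k) (N : charted E) (P : charted F).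
Variables (pi : P -> N) (act : P -> 'M[R]_k -> P).

(* psi : U x H -> pi^-1 U is an equivariant diffeomorphism over U, with inverse
   u |-> (pi u, kappa u). *)
Definition local_trivialization (U : set N)
    (psi : prodc N (vec 'M[R]_k) -> P) (kappa : P -> vec 'M[R]_k) : Prop :=
  [/\ forall y h, U y -> H h -> pi (psi (y, h)) = y /\ kappa (psi (y, h)) = h,
      forall u, U (pi u) -> H (kappa u) /\ psi (pi u, kappa u) = u,
      forall y h g, U y -> H h -> H g -> act (psi (y, h)) g = psi (y, h *m g),
      smooth_within [set yh : prodc N (vec 'M[R]_k) | U yh.1 /\ H yh.2] psi
    & smooth_within (pi @^-1` U) kappa].

End LocalTrivialization.

(* H is meant to be a closed matrix group, with its Lie group structure of
   embedded submanifold of the space of matrices; [bact] is meaningful on H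
   only. The total space is not assumed connected, as H need not be. *)
Record principal_bundle {R : realType} {E : normedModType R} {k : nat}
    (H : set 'M[R]_k) (N : charted E) := PrincipalBundle {
  bdim : nat;
  total :> charted 'rV[R]_bdim;
  bproj : total -> N;
  bact : total -> 'M[R]_k -> total;
  total_manifold : is_manifold total;
  bproj_smooth : forall u, smooth_at bproj u;
  bact1 : forall u, bact u 1%:M = u;
  bactM : forall u g h, H g -> H h -> bact (bact u g) h = bact u (g *m h);
  bact_fiber : forall u h, H h -> bproj (bact u h) = bproj u;
  bact_smooth : smooth_within [set uh : prodc total (vec 'M[R]_k) | H uh.2]
    ((fun uh => bact uh.1 uh.2) : prodc total (vec 'M[R]_k) -> total);
  btrivial : forall x, exists (U : set N) psi kappa, [/\ open U, U x
    & local_trivialization H bproj bact U psi kappa] }.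

Definition lor {R : realType} {m : nat} (v w : 'cV[R]_m.+2) : R :=
  \sum_(i < m.+1) v (lift ord_max i) 0 * w (lift ord_max i) 0
  - v ord_max 0 * w ord_max 0.

Definition future {R : realType} {m : nat} (v : 'cV[R]_m.+2) : Prop :=
  lor v v = 0 /\ 0 < v ord_max 0.

Definition adapted_basis {R : realType} {m : nat} (ell : 'cV[R]_m.+2)
    (e : 'I_m -> 'cV[R]_m.+2) (n : 'cV[R]_m.+2) : Prop :=
  [/\ future ell, lor ell n = 1, lor n n = 0,
      forall i, lor ell (e i) = 0 /\ lor n (e i) = 0
    & forall i j, lor (e i) (e j) = (i == j)%:R].

Definition groupG {R : realType} {m : nat} : set 'M[R]_m.+2 :=
  [set g | (forall v w, lor (g *m v) (g *m w) = lor v w) /\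
           (forall v, future (g *m v) <-> future v)].

Definition groupH {R : realType} {m : nat} (ell : 'cV[R]_m.+2)
  : set 'M[R]_m.+2 := [set h | groupG h /\ h *m ell = ell].

(* In an adapted basis (ell, e_1, ..., e_m, n) the skew-adjoint A are the
   matrices with rows (a, zeta, 0), (X, B, - zeta^T), (0, - X^T, - a), where B
   is skew-symmetric; the subalgebra of the isotropy group of ell is then given
   by a = 0, X = 0. *)
Definition lieG {R : realType} {m : nat} : set 'M[R]_m.+2 :=
  [set A | forall v w, lor (A *m v) w + lor v (A *m w) = 0].

Definition lieH {R : realType} {m : nat} (ell : 'cV[R]_m.+2)
  : set 'M[R]_m.+2 := [set A | lieG A /\ A *m ell = 0].

(* The class (a, X) of A in g/h: in the adapted basis the first column of A is
   A ell = a ell + \sum_i X_i e_i. *)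
Definition mod_h {R : realType} {m : nat} (ell : 'cV[R]_m.+2)
    (e : 'I_m -> 'cV[R]_m.+2) (n : 'cV[R]_m.+2) (A : 'M[R]_m.+2)
  : R * 'cV[R]_m := (lor (A *m ell) n, \col_i lor (A *m ell) (e i)).

Definition qform {R : realType} {m : nat} (a b : R * 'cV[R]_m) : R :=
  (a.2^T *m b.2) 0 0.

(* In [omega_fundamental] the fundamental vector of X at u is the velocity at
   t = 0 of u . gamma t, for any curve gamma in H with gamma 0 = 1 and
   gamma' 0 = X, such as exp (t X). *)
Record cartan_geometry {R : realType} {m : nat} (ell : 'cV[R]_m.+2)
    (N : charted 'rV[R]_m.+1) := CartanGeometry {
  bundle :> principal_bundle (groupH ell) N;
  omega : forall u : bundle, tangent u -> 'M[R]_m.+2;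
  omega_smooth : smooth_form omega;
  omega_linear : forall u, linear (@omega u);
  omega_inj : forall u, injective (@omega u);
  omega_range : forall u, range (@omega u) = lieG;
  omega_equiv : forall u h (eta : tangent u), groupH ell h ->
    omega (tmap (fun u' : bundle => bact u' h) eta) = invmx h *m omega eta *m h;
  omega_fundamental : forall u (X : 'M[R]_m.+2) (gamma : R -> 'M[R]_m.+2),
    lieH ell X -> gamma 0 = 1%:M -> (\forall t \near 0, groupH ell (gamma t)) ->
    is_derive (0 : R) (1 : R) gamma X ->
    omega (@tmap R R _ (vec R) bundle (fun t => bact u (gamma t)) 0 1) = X }.

Section InducedStructure.
Context {R : realType} {m : nat} {ell : 'cV[R]_m.+2} {N : charted 'rV[R]_m.+1}.
Variables (C : cartan_geometry ell N).
Variables (e : 'I_m -> 'cV[R]_m.+2) (n : 'cV[R]_m.+2).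

Definition phi (u : C) (v : tangent (bproj u)) : R * 'cV[R]_m :=
  xget 0 [set w | exists eta : tangent u,
    tmap (@bproj _ _ _ _ _ C) eta = v /\ w = mod_h ell e n (omega eta)].

Definition h_omega (x : N) (v w : tangent x) : R :=
  xget 0 [set r | exists u : C, bproj u = x /\
    r = qform (@phi u v) (@phi u w)].

Definition Z_omega (x : N) : tangent x :=
  xget 0 [set v | exists u : C, bproj u = x /\ @phi u v = (1, 0)].

End InducedStructure.

Section GroupH.
Context {R : realType} {m : nat} (ell : 'cV[R]_m.+2).

Lemma lor_nondeg (v : 'cV[R]_m.+2) : (forall w, lor v w = 0) -> v = 0.
Proof.
move=> v0; apply/colP => i; rewrite mxE.
have := v0 (delta_mx i 0); rewrite /lor.
case: (unliftP ord_max i) => [j ->|->].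
  rewrite (bigD1 j) //= big1 ?addr0.
    by rewrite !mxE !eqxx mulr1 (negbTE (neq_lift _ _)) mulr0 subr0.
  by move=> k kj; rewrite !mxE (inj_eq lift_inj) (negbTE kj) mulr0.
rewrite big1 ?sub0r.
  by rewrite !mxE !eqxx mulr1 => /eqP; rewrite oppr_eq0 => /eqP.
by move=> k _; rewrite !mxE eq_sym (negbTE (neq_lift _ _)) mulr0.
Qed.

Lemma groupG_unit (g : 'M[R]_m.+2) : groupG g -> g \in unitmx.
Proof.
move=> [gi _]; rewrite -unitmx_tr unitmxE unitfE; apply/det0P => -[v v0 vg].
have gv : g *m v^T = 0 by apply: trmx_inj; rewrite trmx_mul trmxK vg trmx0.
case/eqP: v0; apply: trmx_inj; rewrite trmx0; apply: lor_nondeg => w.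
by rewrite -gi gv /lor big1 ?mxE ?mul0r ?subr0 // => k _; rewrite mxE mul0r.
Qed.

Lemma groupH1 : groupH ell 1%:M.
Proof. by split; [split=> v *; rewrite !mul1mx | rewrite mul1mx]. Qed.

Lemma groupHM g h : groupH ell g -> groupH ell h -> groupH ell (g *m h).
Proof.
move=> [[gi gf] gl] [[hi hf] hl]; split; last by rewrite -mulmxA hl gl.
by split=> [v w|v]; rewrite -!mulmxA ?gi ?hi //; apply: iff_trans (gf _) (hf _).
Qed.

Lemma groupHV g : groupH ell g -> groupH ell (invmx g).
Proof.
move=> [gG gl]; have gU := groupG_unit gG; have [gi gf] := gG.
split; last by rewrite -[X in _ *m X]gl mulKmx.
split=> [v w|v]; [by rewrite -gi !mulKVmx | by rewrite -gf mulKVmx].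
Qed.

End GroupH.

Section Tractor.
Context {R : realType} {m : nat} {ell : 'cV[R]_m.+2} {N : charted 'rV[R]_m.+1}.
Variable C : cartan_geometry ell N.

Definition tractor_rel (a b : C * 'cV[R]_m.+2) : bool :=
  `[< exists2 h, groupH ell h & b = (bact a.1 h, invmx h *m a.2) >].

Lemma tractor_rel_refl : reflexive tractor_rel.
Proof.
move=> [u v]; apply/asboolP; exists 1%:M; first exact: groupH1.
by rewrite bact1 invmx1 mul1mx.
Qed.

Lemma tractor_rel_sym : symmetric tractor_rel.
Proof.
suff sym a b : tractor_rel a b -> tractor_rel b a.
  by move=> a b; apply/idP/idP; exact: sym.
case: a => u v /asboolP[h Hh ->]; apply/asboolP; exists (invmx h).
  exact: groupHV.
have hU : h \in unitmx by apply: groupG_unit; case: Hh.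
by rewrite /= bactM ?mulmxV ?bact1 ?invmxK ?mulKVmx //; exact: groupHV.
Qed.

Lemma tractor_rel_trans : transitive tractor_rel.
Proof.
move=> b [u v] c /asboolP[g Hg ->] /asboolP[h Hh ->]; apply/asboolP.
exists (g *m h); first exact: groupHM.
have gU : g \in unitmx by apply: groupG_unit; case: Hg.
have hU : h \in unitmx by apply: groupG_unit; case: Hh.
have ghU : g *m h \in unitmx by rewrite unitmx_mul gU.
by rewrite /= bactM // -{1}[v](mulKVmx ghU) -mulmxA !mulKmx.
Qed.

Definition tractor_equiv :=
  EquivRel tractor_rel tractor_rel_refl tractor_rel_sym tractor_rel_trans.

Definition tractor := {eq_quot tractor_equiv}.

Definition tclass (u : C) (v : 'cV[R]_m.+2) : tractor := \pi_tractor (u, v).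

Definition tproj (t : tractor) : N := bproj (repr t).1.

(* The v with t = [u, v], for t in the fibre over bproj u. *)
Definition tcoord (u : C) (t : tractor) : 'cV[R]_m.+2 :=
  xget 0 [set v | t = tclass u v].

(* Fibrewise operations: [tadd] and [tmetric] are meaningful when t1 and t2
   lie in the same fibre. *)
Definition tadd (t1 t2 : tractor) : tractor :=
  let u := (repr t1).1 in tclass u (tcoord u t1 + tcoord u t2).

Definition tscale (a : R) (t : tractor) : tractor :=
  let u := (repr t).1 in tclass u (a *: tcoord u t).

Definition tzero (t : tractor) : Prop := exists u, t = tclass u 0.

Definition tmetric (t1 t2 : tractor) : R :=
  let u := (repr t1).1 in lor (tcoord u t1) (tcoord u t2).

(* A smooth expression sigma = [s, f] around x, with s a local section of the
   principal bundle. *)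
Definition local_rep (sigma : N -> tractor) (x : N) (s : N -> C)
    (f : N -> vec 'cV[R]_m.+2) : Prop :=
  [/\ smooth_at s x, smooth_at f x,
      \forall y \near x, bproj (s y) = y
    & \forall y \near x, sigma y = tclass (s y) (f y)].

Definition smooth_on_tractor (U : set N) (sigma : N -> tractor) : Prop :=
  forall x, U x -> exists s f, local_rep sigma x s f.

Record smooth_section (sigma : N -> tractor) : Prop := SmoothSection {
  section_proj : forall x, tproj (sigma x) = x;
  section_smooth : smooth_on_tractor setT sigma }.

Definition lightlike_section (sigma : N -> tractor) : Prop :=
  forall x, ~ tzero (sigma x) /\ tmetric (sigma x) (sigma x) = 0.

(* [s, W f + omega (Ts W) f]; the value does not depend on the local
   expression sigma = [s, f] chosen. *)
Definition nabla (sigma : N -> tractor) (x : N) (W : tangent x) : tractor :=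
  xget (sigma x) [set t | exists s f, local_rep sigma x s f /\
    t = tclass (s x) (tmap f W + omega (tmap s W) *m f x)].

(* Morphisms of vector bundles TN -> T over the identity of N: fibre
   preserving, fibrewise linear, and smooth, smoothness being tested on the
   coordinate frames of TN. *)
Record bundle_morphism (Phi : forall x : N, tangent x -> tractor) : Prop :=
    BundleMorphism {
  morph_proj : forall x (v : tangent x), tproj (Phi x v) = x;
  morph_linear : forall x a (v w : tangent x),
    Phi x (a *: v + w) = tadd (tscale a (Phi x v)) (Phi x w);
  morph_smooth : forall (i : chart N) (v : 'rV[R]_m.+1),
    smooth_on_tractor (dom i) (fun y => Phi y (coord_field i v y)) }.

Definition bundle_monomorphism (Phi : forall x : N, tangent x -> tractor)
  : Prop := bundle_morphism Phi /\ forall x, injective (Phi x).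

End Tractor.

(* Main.v *)
(** The section is xi = [u, ell], well defined because H fixes ell. In a local
    section s of the bundle it reads [s, ell] with ell constant, so that
    nabla_W xi = [s, omega (Ts W) ell], and A ell only depends on the class of
    A in g/h. Hence nabla_W xi = [u, omega eta ell] for every eta over W, once
    one knows that omega maps vertical vectors into h: a vertical vector is the
    velocity of a curve u . gamma t with gamma in H. Since omega is onto g and
    g ell is the orthogonal of ell, which has the dimension of N, the map
    W |-> nabla_W xi is injective; expanding A ell in the adapted basis gives
    the isometry and the image of Z. *)

From HB Require Import structures.
From mathcomp Require Import all_boot all_order all_algebra generic_quotient.
From mathcomp Require Import all_classical all_reals all_analysis.
From mathcomp Require Import ring.
(* Imported last: [coord] is also a constant of the vector space library. *)
Require Import Defs.

Set Implicit Arguments.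
Unset Strict Implicit.
Unset Printing Implicit Defensive.

Import Order.TTheory GRing.Theory Num.Theory.
Import numFieldNormedType.Exports.
Local Open Scope classical_set_scope.
Local Open Scope ring_scope.

(** * Calculus of C^k maps *)

(** The values [phi], [h_omega], [Z_omega] and [nabla] are picked by [xget], so each is computed by
    showing that every candidate gives the expected result and that a candidate exists, which
    excludes the default. Tangent vectors are written in preferred charts, which may jump from point
    to point; smoothness of the covariant derivative is therefore proved in one fixed pair of
    charts, and this is what the calculus of change of charts is for. Smoothness on U x H means
    local smooth extension, so [psi], [kappa] and the action are replaced near a point by extensions
    that say something about the bundle only where the matrix argument lies in H. The number [bdim]
    is not expressed through m, so the dimension count behind injectivity takes place on the base,
    with projections of lifted vectors forming a square matrix. *)

Section Germs.
Context {R : realType} {E F : normedModType R}.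
Implicit Types (f g : E -> F) (x v : E).

(** The first-order expansion of f at x only involves f near x, so it is also an expansion of g;
    [diff_unique] then identifies the differential of g with that of f. *)
Lemma near_eq_differentiable f g x : (\near x, f x = g x) ->
  differentiable f x -> differentiable g x.
Proof.
move=> fg df; have fgx := nbhs_singleton fg.
suff [] : continuous ('d f x) /\ g \o shift x = cst (g x) + 'd f x +o_ 0 id.
  move=> dc dE; apply/diff_locallyP.
  by rewrite (diff_unique dc dE); split.
split; first exact: diff_continuous.
apply/eqaddoP => eps eps0.
have /eqaddoP /(_ _ eps0) := diff_locally df.
have : \forall y \near (0 : E), f (y + x) = g (y + x).
  by move: fg; rewrite (near_shift 0) subr0.
apply: filterS2 => y /= fgy.
rewrite -![(_ + _ : _ -> _) _]/(_ + _) -![(- _ : _ -> _) _]/(- _) /= /cst.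
by rewrite fgy fgx.
Qed.

Lemma near_eq_diff f g x v : (\near x, f x = g x) -> differentiable f x ->
  'd f x v = 'd g x v.
Proof.
move=> fg df; have dg := near_eq_differentiable fg df.
by rewrite -!deriveE // (near_eq_derive _ fg).
Qed.

End Germs.

Section Ck.
Context {R : realType}.
Implicit Types E F : normedModType R.

Lemma open_near (T : topologicalType) (U : set T) x (P : T -> Prop) :
  open U -> U x -> (forall y, U y -> P y) -> \forall y \near x, P y.
Proof. by move=> oU Ux UP; apply: filterS (open_nbhs_nbhs (conj oU Ux)). Qed.

Lemma Ck_on_ext E F k (U : set E) (f g : E -> F) : open U ->
  (forall x, U x -> f x = g x) -> Ck_on k U f -> Ck_on k U g.
Proof.
move=> oU; elim: k f g => [|k IH] f g fg /=.
  move=> fc x Ux; have fgx : \near x, f x = g x by apply: open_near fg.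
  suff : g @ x --> f x by rewrite fg.
  by apply: cvg_trans (fc x Ux); exact: near_eq_cvg.
move=> [fd fk]; split=> [x Ux|v].
  by apply: near_eq_differentiable (fd x Ux); apply: open_near fg.
apply: IH (fk v) => x Ux; apply: near_eq_derive.
exact: open_near fg.
Qed.

Lemma Ck_on_sub E F k (U V : set E) (f : E -> F) : U `<=` V ->
  Ck_on k V f -> Ck_on k U f.
Proof.
move=> UV; elim: k f => [|k IH] f /=; first by move=> fc x /UV; exact: fc.
by move=> [fd fk]; split=> [x /UV|v]; [exact: fd|exact: IH].
Qed.

Lemma Ck_on_pred E F k (U : set E) (f : E -> F) :
  Ck_on k.+1 U f -> Ck_on k U f.
Proof.
elim: k f => [|k IH] f [fd fk].
  by move=> x Ux; apply: differentiable_continuous; exact: fd.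
by split=> // v; apply: IH; exact: fk.
Qed.

Lemma Ck_on_cst E F k (U : set E) (c : F) : Ck_on k U (fun=> c).
Proof.
elim: k c => [|k IH] c /=; first by move=> x _; exact: cst_continuous.
split=> [x _|v]; first exact: differentiable_cst.
suff -> : (fun x => 'D_v (fun=> c) x) = (fun=> 0 : F) by exact: IH.
by apply/funext => x; exact: derive_cst.
Qed.

Lemma Ck_onD E F k (U : set E) (f g : E -> F) : open U ->
  Ck_on k U f -> Ck_on k U g -> Ck_on k U (f + g).
Proof.
move=> oU; elim: k f g => [|k IH] f g /=.
  by move=> fc gc x Ux; apply: continuousD; [exact: fc|exact: gc].
move=> [fd fk] [gd gk]; split=> [x Ux|v].
  by apply: differentiableD; [exact: fd|exact: gd].
apply: Ck_on_ext (IH _ _ (fk v) (gk v)) => // x Ux.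
rewrite [RHS]deriveD //; apply: diff_derivable; [exact: fd|exact: gd].
Qed.

Lemma Ck_on_sum E F k (U : set E) I (r : seq I) (P : pred I) (f : I -> E -> F) :
  open U -> (forall i, Ck_on k U (f i)) ->
  Ck_on k U (fun x => \sum_(i <- r | P i) f i x).
Proof.
move=> oU fk; elim: r => [|i r IH].
  apply: Ck_on_ext (Ck_on_cst k U (0 : F)) => // x _.
  by rewrite big_nil.
have [Pi|nPi] := boolP (P i).
  apply: Ck_on_ext (Ck_onD oU (fk i) IH) => // x _.
  by rewrite big_cons Pi.
by apply: Ck_on_ext IH => // x _; rewrite big_cons (negbTE nPi).
Qed.

Lemma Ck_on_linear E F (G : normedModType R) k (U : set E)
  (L : {linear F -> G}) (f : E -> F) :
  open U -> continuous L -> Ck_on k U f -> Ck_on k U (L \o f).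
Proof.
move=> oU Lc; elim: k f => [|k IH] f /=.
  by move=> fc x Ux; apply: continuous_comp; [exact: fc|exact: Lc].
move=> [fd fk]; have Ld y : differentiable L y by exact: linear_differentiable.
split=> [x Ux|v]; first by apply: differentiable_comp; [exact: fd|].
apply: Ck_on_ext (IH _ (fk v)) => // x Ux.
rewrite [RHS]deriveE; last by apply: differentiable_comp; [exact: fd|].
rewrite diff_comp //=; last exact: fd.
by rewrite (diff_lin _ Lc) -deriveE //; exact: fd.
Qed.

Lemma Ck_onZl E F k (U : set E) (f : E -> R) (w : F) : open U ->
  Ck_on k U f -> Ck_on k U (fun x => f x *: w).
Proof.
pose L (a : R) := a *: w.
have L_lin : linear L by move=> a x y; rewrite /L scalerDl scalerA.
pose LM := GRing.isLinear.Build _ _ _ _ L L_lin.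
pose LL : {linear R -> F} := HB.pack L LM.
move=> oU; apply: (Ck_on_linear (L := LL) oU).
exact: scalel_continuous.
Qed.

Lemma Ck_onM E k (U : set E) (f g : E -> R) : open U ->
  Ck_on k U f -> Ck_on k U g -> Ck_on k U (f * g).
Proof.
move=> oU; elim: k f g => [|k IH] f g fk gk.
  by move=> x Ux; apply: continuousM; [exact: fk|exact: gk].
have [fd fv] := fk; have [gd gv] := gk; split=> [x Ux|v].
  by apply: differentiableM; [exact: fd|exact: gd].
apply: Ck_on_ext (Ck_onD oU (IH _ _ (Ck_on_pred fk) (gv v))
  (IH _ _ (Ck_on_pred gk) (fv v))) => // x Ux.
rewrite [RHS]deriveM //; apply: diff_derivable; [exact: fd|exact: gd].
Qed.

Lemma Ck_on_mxP E m n k (U : set E) (f : E -> 'M[R]_(m, n)) : open U ->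
  Ck_on k U f <-> forall i j, Ck_on k U (fun x => f x i j).
Proof.
move=> oU; split=> [fk i j|fk].
  pose c (M : 'M[R]_(m, n)) : R := M i j.
  have c_lin : linear c by move=> a M M'; rewrite /c !mxE.
  pose L : {linear 'M[R]_(m, n) -> R} :=
    HB.pack c (GRing.isLinear.Build _ _ _ _ c c_lin).
  exact: (Ck_on_linear (L := L) oU (@coord_continuous _ _ _ i j) fk).
suff : Ck_on k U (fun x =>
    \sum_i \sum_j f x i j *: delta_mx i j : 'M[R]_(m, n)).
  by apply: Ck_on_ext => // x _; rewrite [RHS]matrix_sum_delta.
apply: Ck_on_sum => // i; apply: Ck_on_sum => // j.
exact: Ck_onZl (fk i j).
Qed.

(** [Ck_on] only speaks of derivatives in constant directions, whereas the chain rule differentiates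
    g at f x in the moving direction ['D_v f x]. Expanding this direction in the standard basis of
    row vectors gives the sum of the products [t a], each of which is covered by the induction and
    [Ck_onM]. *)
Lemma Ck_on_comp E q k (U : set E) (V : set 'rV[R]_q) (f : E -> 'rV[R]_q)
  (g : 'rV[R]_q -> R) : open U -> (forall x, U x -> V (f x)) ->
  Ck_on k U f -> Ck_on k V g -> Ck_on k U (g \o f).
Proof.
move=> oU UV; elim: k g => [|k IH] g fk gk.
  move=> x Ux; apply: continuous_comp; [exact: fk|apply: gk; exact: UV].
have [fd fv] := fk; have [gd gv] := gk; split=> [x Ux|v].
  by apply: differentiable_comp; [exact: fd|apply: gd; exact: UV].
pose t a := (fun x => ('D_v f x) 0 a) * ('D_(delta_mx 0 a) g \o f).
suff : Ck_on k U (fun x => \sum_a t a x).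
  apply: Ck_on_ext => // x Ux.
  have gdx : differentiable g (f x) by apply: gd; exact: UV.
  rewrite [RHS]deriveE; last by apply: differentiable_comp => //; exact: fd.
  rewrite diff_comp //=; last exact: fd.
  rewrite -(deriveE v (fd x Ux)) [X in 'd g _ X]row_sum_delta linear_sum.
  apply: eq_bigr => a _.
  by rewrite linearZ /= -deriveE.
apply: Ck_on_sum => // a; apply: Ck_onM => //.
  by move/(Ck_on_mxP _ _ oU): (fv v); apply.
by apply: IH (gv _); exact: Ck_on_pred.
Qed.

Lemma Ck_on_comp_mx E q m n k (U : set E) (V : set 'rV[R]_q) (f : E -> 'rV[R]_q)
  (g : 'rV[R]_q -> 'M[R]_(m, n)) : open U -> open V ->
  (forall x, U x -> V (f x)) ->
  Ck_on k U f -> Ck_on k V g -> Ck_on k U (g \o f).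
Proof.
move=> oU oV UV fk /(Ck_on_mxP _ _ oV) gk; apply/Ck_on_mxP => // i j.
exact: (Ck_on_comp oU UV fk (gk i j)).
Qed.

End Ck.

Section CkMx.
Context {R : realType} {E : normedModType R}.

Lemma Ck_on_mulmxr p q r k (U : set E) (f : E -> 'M[R]_(p, q))
  (B : 'M[R]_(q, r)) : open U ->
  Ck_on k U f -> Ck_on k U (fun x => f x *m B).
Proof.
move=> oU /(Ck_on_mxP _ _ oU) fk; apply/(Ck_on_mxP _ _ oU) => i j.
apply: (@Ck_on_ext _ _ _ _ _ (fun x => \sum_l f x i l *: B l j)) => //.
  by move=> x _; rewrite mxE.
by apply: Ck_on_sum => // l; exact: Ck_onZl.
Qed.

Lemma Ck_onZ p q k (U : set E) (c : E -> R) (f : E -> 'M[R]_(p, q)) : open U ->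
  Ck_on k U c -> Ck_on k U f -> Ck_on k U (fun x => c x *: f x).
Proof.
move=> oU ck /(Ck_on_mxP _ _ oU) fk; apply/(Ck_on_mxP _ _ oU) => i j.
apply: (@Ck_on_ext _ _ _ _ _ (c * (fun x => f x i j))) => //.
  by move=> x _; rewrite mxE.
exact: Ck_onM.
Qed.

End CkMx.

(** * Charts *)

Section Charts.
Context {R : realType}.
Implicit Types E F G : normedModType R.

(* Weaker than [is_manifold], so as to hold for products as well. *)
Definition chart_around {E} (M : charted E) (i : chart M) (x : M) : Prop :=
  [/\ \forall y \near x, dom i y,
      \forall y \near x, par i (coord i y) = y,
      {for x, continuous (coord i)}
    & {for coord i x, continuous (par i : E -> M)}].

Lemma manifold_chart_around E (M : charted E) (i : chart M) (x : M) :
  is_manifold M -> dom i x -> chart_around i x.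
Proof.
move=> hM xi; have nx : \forall y \near x, dom i y.
  by apply: open_nbhs_nbhs; split=> //; exact: mfd_dom_open.
split=> //.
- by apply: filterS nx => y; exact: mfd_coordK.
- exact: mfd_coord_cont.
- exact: mfd_par_cont.
Qed.

Lemma vec_chart_around E (i : chart (vec E)) (x : vec E) : chart_around i x.
Proof.
split; [exact: filterT|exact: filterE|by move=> A|by move=> A].
Qed.

Lemma prod_chart_around E F (M : charted E) (N : charted F)
  (i : chart (prodc M N)) (x : prodc M N) :
  chart_around i.1 x.1 -> chart_around i.2 x.2 -> chart_around i x.
Proof.
case: i x => [i j] [x y] [/= d1 k1 c1 p1] [/= d2 k2 c2 p2]; split.
- by exists (dom i, dom j) => // -[a b] [].
- exists ([set a | par i (coord i a) = a], [set b | par j (coord j b) = b]) => //.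
  by move=> [a b] [/= -> ->].
- apply: cvg_pair.
    by apply: (@continuous_comp _ _ _ fst (coord i) (x, y)); [exact: cvg_fst|].
  by apply: (@continuous_comp _ _ _ snd (coord j) (x, y)); [exact: cvg_snd|].
- apply: cvg_pair.
    apply: (@continuous_comp _ _ _ fst (par i) (coord i x, coord j y)) => //.
    exact: cvg_fst.
  apply: (@continuous_comp _ _ _ snd (par j) (coord i x, coord j y)) => //.
  exact: cvg_snd.
Qed.

Lemma chart_around_par E (M : charted E) (i : chart M) (x : M) (P : M -> Prop) :
  chart_around i x -> (\forall y \near x, P y) ->
  \forall z \near coord i x, P (par i z).
Proof.
move=> [_ pK _ pc] nP; apply: pc; rewrite (nbhs_singleton pK).
exact: nP.
Qed.

(** Unlike [local_expr], whose charts depend on the point, this keeps the two charts fixed while the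
    point moves. *)
Definition lexp {E F} {M : charted E} {N : charted F} (i : chart M)
  (k : chart N) (f : M -> N) : E -> F := coord k \o f \o par i.

Lemma lexpE E F (M : charted E) (N : charted F) (i : chart M) (k : chart N)
  (f : M -> N) x : chart_around i x -> lexp i k f (coord i x) = coord k (f x).
Proof. by move=> [_ /nbhs_singleton pK _ _]; rewrite /lexp /= pK. Qed.

Lemma lexp_comp E F G (M : charted E) (N : charted F) (Q : charted G)
  (i : chart M) (k : chart N) (l : chart Q) (f : M -> N) (g : N -> Q) x :
  chart_around i x -> chart_around k (f x) -> {for x, continuous f} ->
  \forall z \near coord i x,
    (lexp k l g \o lexp i k f) z = lexp i l (g \o f) z.
Proof.
move=> ix [_ kK _ _] fc; apply: (@chart_around_par _ _ i x
  (fun y => coord l (g (par k (coord k (f y)))) = coord l (g (f y)))) => //.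
apply: (fc [set w | coord l (g (par k (coord k w))) = coord l (g w)]).
by apply: filterS kK => y /= ->.
Qed.

Lemma lexp_diff_comp E F G (M : charted E) (N : charted F) (Q : charted G)
  (i : chart M) (k : chart N) (l : chart Q) (f : M -> N) (g : N -> Q) x :
  chart_around i x -> chart_around k (f x) -> {for x, continuous f} ->
  differentiable (lexp i k f) (coord i x) ->
  differentiable (lexp k l g) (coord k (f x)) ->
  differentiable (lexp i l (g \o f)) (coord i x) /\
  forall v, 'd (lexp i l (g \o f)) (coord i x) v =
    'd (lexp k l g) (coord k (f x)) ('d (lexp i k f) (coord i x) v).
Proof.
move=> ix kx fc df dg; have e := lexp_comp l g ix kx fc.
rewrite -(lexpE k f ix) in dg *.
have dgf := differentiable_comp df dg.
split; first exact: near_eq_differentiable dgf.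
by move=> v; rewrite -(near_eq_diff v e dgf) diff_comp.
Qed.

(** Continuity is a separate clause because [coord] is a total function with arbitrary values off
    its domain: it is continuity that keeps f near x inside the chart at f x. *)
Definition mdiff {E F} {M : charted E} {N : charted F} (f : M -> N) (x : M) :=
  {for x, continuous f} /\
  differentiable (local_expr f x) (coord (chart_at x) x).

Lemma smooth_at_mdiff E F (M : charted E) (N : charted F) (f : M -> N) x :
  smooth_at f x -> mdiff f x.
Proof. by move=> [fc [W [_ Wx /(_ 1) [fd _]]]]; split=> //; exact: fd. Qed.

Lemma mdiff_comp E F G (M : charted E) (N : charted F) (Q : charted G)
  (f : M -> N) (g : N -> Q) x :
  chart_around (chart_at x) x -> chart_around (chart_at (f x)) (f x) ->
  mdiff f x -> mdiff g (f x) ->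
  mdiff (g \o f) x /\
  forall v : tangent x, tmap (g \o f) v = tmap g (tmap f v) :> G.
Proof.
move=> ix kx [fc df] [gc dg].
have [dgf E1] := lexp_diff_comp ix kx fc df dg.
by split=> //; split=> //; apply: continuous_comp.
Qed.

Lemma local_expr_near E F (M : charted E) (N : charted F) (f g : M -> N) x :
  chart_around (chart_at x) x -> (\forall y \near x, f y = g y) ->
  \forall z \near coord (chart_at x) x, local_expr f x z = local_expr g x z.
Proof.
move=> ix fg; have fgx := nbhs_singleton fg.
apply: (@chart_around_par _ _ _ x
  (fun y => coord _ (f y) = coord _ (g y))) => //.
by apply: filterS fg => y ->; rewrite fgx.
Qed.

Lemma near_eq_mdiff E F (M : charted E) (N : charted F) (f g : M -> N) x :
  chart_around (chart_at x) x -> (\forall y \near x, f y = g y) ->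
  mdiff f x ->
  mdiff g x /\ forall v : tangent x, tmap f v = tmap g v :> F.
Proof.
move=> ix fg [fc fd]; have le := local_expr_near ix fg.
split=> [|v]; last exact: near_eq_diff.
split; last exact: near_eq_differentiable fd.
suff : g @ x --> f x by rewrite (nbhs_singleton fg).
by apply: cvg_trans fc; exact: near_eq_cvg.
Qed.

Lemma mdiff_pair E F G (M : charted E) (N : charted F) (Q : charted G)
  (f : M -> N) (g : M -> Q) x : mdiff f x -> mdiff g x ->
  mdiff ((fun y => (f y, g y)) : M -> prodc N Q) x /\
  forall v : tangent x, tmap ((fun y => (f y, g y)) : M -> prodc N Q) v =
    (tmap f v, tmap g v) :> F * G.
Proof.
move=> [fc fd] [gc gd]; split.
  split; first exact: cvg_pair.
  exact: (differentiable_pair fd gd).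
by move=> v; have := diff_pair fd gd => /(congr1 (@^~ v)).
Qed.

Lemma mdiff_cst E F (M : charted E) (N : charted F) (c : N) (x : M) :
  mdiff (fun=> c) x.
Proof.
split; first exact: cst_continuous.
exact: (differentiable_cst (coord (chart_at c) c)).
Qed.

Lemma manifold_img_near E (M : charted E) (i : chart M) x :
  is_manifold M -> dom i x ->
  \forall z \near coord i x, dom i (par i z) /\ coord i (par i z) = z.
Proof.
move=> hM xi; apply: (open_near (mfd_img_open hM i)); first by exists x.
by move=> _ [y yi <-]; rewrite mfd_coordK.
Qed.

Lemma mdiff_id E (M : charted E) (x : M) : is_manifold M ->
  mdiff (id : M -> M) x /\ forall v : tangent x, tmap (id : M -> M) v = v :> E.
Proof.
move=> hM; have e : \forall z \near coord (chart_at x) x,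
    id z = local_expr (id : M -> M) x z.
  apply: filterS (manifold_img_near hM (mfd_cover hM x)) => z [_ zE].
  by rewrite /local_expr /= zE.
have did : differentiable (id : E -> E) (coord (chart_at x) x) by [].
split; first by split; [|exact: near_eq_differentiable did].
move=> v; rewrite /tmap -(near_eq_diff v e did).
by rewrite diff_val.
Qed.

(** * Change of charts *)

Lemma transition_diff E (M : charted E) (i j : chart M) x :
  is_manifold M -> dom i x -> dom j x ->
  differentiable (lexp i j id) (coord i x).
Proof.
move=> hM xi xj; have [d _] := mfd_compat hM i j 1.
by apply: d; exists x.
Qed.

(** Writing f as f after the identity and as the identity after f, the expression of f in the mixed
    pair [i], [k'] factors through a transition map on either side. *)
Lemma lexp_diff_change E F (M : charted E) (N : charted F) (hM : is_manifold M)
  (hN : is_manifold N) (i i' : chart M) (k k' : chart N) (f : M -> N) x :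
  dom i x -> dom i' x -> dom k (f x) -> dom k' (f x) ->
  {for x, continuous f} -> differentiable (lexp i k f) (coord i x) ->
  differentiable (lexp i' k' f) (coord i' x) /\
  forall v, 'd (lexp i k' f) (coord i x) v =
    'd (lexp i' k' f) (coord i' x) ('d (lexp i i' id) (coord i x) v) /\
    'd (lexp i k' f) (coord i x) v =
    'd (lexp k k' id) (coord k (f x)) ('d (lexp i k f) (coord i x) v).
Proof.
move=> xi xi' xk xk' fc df.
have ci := manifold_chart_around hM xi; have ci' := manifold_chart_around hM xi'.
have ck := manifold_chart_around hN xk.
have [d1 E1] := lexp_diff_comp ci ck fc df (transition_diff hN xk xk').
have idc : {for x, continuous (id : M -> M)} by [].
have [d2 E2] := lexp_diff_comp ci' ci idc (transition_diff hM xi' xi) d1.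
have [d3 E3] := lexp_diff_comp ci ci' idc (transition_diff hM xi xi') d2.
by split.
Qed.

(** Both sides are the differential of f from the chart [i] to the preferred chart at f x, factored
    through the source or through the target. This turns [tmap], tied to preferred charts, into a
    derivative in charts that stay fixed as x varies. *)
Lemma tmap_coord_field E F (M : charted E) (N : charted F) (hM : is_manifold M)
  (hN : is_manifold N) (i : chart M) (k : chart N) (f : M -> N) x v :
  dom i x -> dom k (f x) -> mdiff f x ->
  tmap f (coord_field i v x) =
  coord_field k ('d (lexp i k f) (coord i x) v) (f x).
Proof.
move=> xi xk [fc df]; have c0 := mfd_cover hM x; have c1 := mfd_cover hN (f x).
have [d1 _] := lexp_diff_change hM hN c0 xi c1 xk fc df.
have [d2 E1] := lexp_diff_change hM hN xi c0 xk c1 fc d1.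
by have [e1 e2] := E1 v; exact: etrans (esym e1) e2.
Qed.

Lemma mdiff_lexp E F (M : charted E) (N : charted F) (hM : is_manifold M)
  (hN : is_manifold N) (i : chart M) (k : chart N) (f : M -> N) x :
  dom i x -> dom k (f x) -> {for x, continuous f} ->
  differentiable (lexp i k f) (coord i x) -> mdiff f x.
Proof.
move=> xi xk fc df; split=> //.
by have [] := lexp_diff_change hM hN xi (mfd_cover hM x) xk
  (mfd_cover hN (f x)) fc df.
Qed.

Lemma transition_dom_open E (M : charted E) (i j : chart M) : is_manifold M ->
  open (coord i @` (dom i `&` dom j)).
Proof.
move=> hM; rewrite openE => _ [x [xi xj] <-]; rewrite /interior /=.
have ci := manifold_chart_around hM xi.
have xj' := open_near (mfd_dom_open hM j) xj (fun _ h => h).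
apply: filterS2 (manifold_img_near hM xi) (chart_around_par ci xj').
by move=> z [zi zE] zj; exists (par i z).
Qed.

(** The expression of f in [i] and [k] is its expression in the preferred charts, composed with a
    smooth transition map on each side. *)
Lemma smooth_at_chart p q (M : charted 'rV[R]_p) (N : charted 'rV[R]_q)
  (hM : is_manifold M) (hN : is_manifold N) (i : chart M) (k : chart N)
  (f : M -> N) x : dom i x -> dom k (f x) -> smooth_at f x ->
  exists W, [/\ open W, W (coord i x), W `<=` coord i @` dom i,
    forall z, W z -> dom k (f (par i z)) & Cinfty_on W (lexp i k f)].
Proof.
move=> xi xk [fc [W0 [oW0 W0x fW0]]].
set i0 := chart_at x in fW0 W0x *; set k0 := chart_at (f x).
have x0 : dom i0 x by exact: mfd_cover.
have fx0 : dom k0 (f x) by exact: mfd_cover.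
have ci := manifold_chart_around hM xi.
pose A := [set z | [/\ dom i (par i z), coord i (par i z) = z &
  [/\ dom i0 (par i z), W0 (coord i0 (par i z)),
     dom k0 (f (par i z)) & dom k (f (par i z))]]].
have oD E (Q : charted E) (j : chart Q) y : is_manifold Q -> dom j y ->
    \forall w \near y, dom j w.
  by move=> hQ yj; exact: (open_near (mfd_dom_open hQ j)).
have Ax : \forall z \near coord i x, A z.
  apply: filterS2 (manifold_img_near hM xi) (chart_around_par ci
    (filterI (filterI (oD _ _ _ _ hM x0) (mfd_coord_cont hM x0
      (open_nbhs_nbhs (conj oW0 W0x))))
     (filterI (fc _ (oD _ _ _ _ hN fx0)) (fc _ (oD _ _ _ _ hN xk))))).
  by move=> z [zi zE] [[? ?] [? ?]].
(* f is only known to be continuous at x, so A is merely a neighbourhood of [coord i x]; its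
   interior is the open set wanted. *)
exists A^°; split.
- exact: open_interior.
- exact: Ax.
- by move=> z /interior_subset[zi zE _]; exists (par i z).
- by move=> z /interior_subset[_ _ []].
move=> m; apply: (@Ck_on_ext _ _ _ _ _
  (lexp k0 k id \o (local_expr f x \o lexp i i0 id))).
- exact: open_interior.
- move=> z /interior_subset[zi zE [z0 _ zk0 zk]].
  by rewrite /local_expr /lexp /= (mfd_coordK hM z0) (mfd_coordK hN zk0).
have oA : open A^° by exact: open_interior.
apply: (Ck_on_comp_mx oA (transition_dom_open k0 k hN)).
- move=> z /interior_subset[zi zE [z0 _ zk0 zk]].
  exists (f (par i z)) => //.
  by rewrite /local_expr /lexp /= (mfd_coordK hM z0).
- apply: (Ck_on_comp_mx oA oW0); last exact: fW0.
    by move=> z /interior_subset[_ _ []].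
  apply: Ck_on_sub (mfd_compat hM i i0 m) => z /interior_subset[zi zE [z0 _ _ _]].
  by exists (par i z).
- exact: mfd_compat.
Qed.

Lemma smooth_at_vec p m n (M : charted 'rV[R]_p) (hM : is_manifold M)
  (i : chart M) (f : M -> vec 'M[R]_(m, n)) x (W : set 'rV[R]_p) : dom i x ->
  open W -> W (coord i x) ->
  Cinfty_on W (lexp i (tt : chart (vec 'M[R]_(m, n))) f) -> smooth_at f x.
Proof.
move=> xi oW Wx fW; set i0 := chart_at x.
have x0 : dom i0 x by exact: mfd_cover.
have c0 := manifold_chart_around hM x0.
split.
  pose fi := lexp i (tt : chart (vec 'M[R]_(m, n))) f.
  have gc : {for x, continuous (fi \o coord i)}.
    apply: continuous_comp; first exact: mfd_coord_cont.
    exact: (fW 0).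
  have e : \forall y \near x, (fi \o coord i) y = f y.
    apply: (open_near (mfd_dom_open hM i) xi) => y yi.
    by rewrite /fi /lexp /= mfd_coordK.
  suff : f @ x --> (fi \o coord i) x.
    by rewrite (nbhs_singleton e).
  by apply: cvg_trans gc; exact: near_eq_cvg.
pose A := [set z | [/\ dom i0 (par i0 z), coord i0 (par i0 z) = z,
  dom i (par i0 z) & W (coord i (par i0 z))]].
have Ax : \forall z \near coord i0 x, A z.
  apply: filterS2 (manifold_img_near hM x0) (chart_around_par c0
    (filterI (open_near (mfd_dom_open hM i) xi (fun _ h => h))
      (mfd_coord_cont hM xi (open_nbhs_nbhs (conj oW Wx))))).
  by move=> z [zi zE] [? ?].
have oA : open A^° by exact: open_interior.
exists A^°; split=> // k.
apply: (@Ck_on_ext _ _ _ _ _ (lexp i (tt : chart (vec _)) f \o lexp i0 i id)) => //.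
  move=> z /interior_subset[_ _ zi _].
  by rewrite /lexp /local_expr /= (mfd_coordK hM zi).
apply: (Ck_on_comp_mx oA oW); last exact: fW.
  by move=> z /interior_subset[].
apply: Ck_on_sub (mfd_compat hM i0 i k) => z /interior_subset[z0 zE zi _].
by exists (par i0 z).
Qed.

Lemma smooth_at_cst E F (M : charted E) (c : vec F) (x : M) :
  smooth_at ((fun=> c) : M -> vec F) x.
Proof.
split; first exact: cst_continuous.
by exists setT; split=> // [|k]; [exact: openT|exact: Ck_on_cst].
Qed.

Lemma pairl_continuous (S T : topologicalType) (c : T) :
  continuous (fun z : S => (z, c)).
Proof. by move=> z; apply: cvg_pair; [exact: cvg_id|exact: cvg_cst]. Qed.

(** The derivative of a slice along v is the slice of the derivative along (v, 0), so the induction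
    stays among slices. *)
Lemma Ck_on_pairl E F G k (W : set (E * F)) (f : E * F -> G) (c : F) :
  open W -> Ck_on k W f -> Ck_on k [set z | W (z, c)] (fun z => f (z, c)).
Proof.
move=> oW; elim: k f => [|k IH] f /=.
  move=> fc z Wz; apply: (@continuous_comp _ _ _ (fun z => (z, c)) f).
    exact: pairl_continuous.
  exact: fc.
move=> [fd fv]; split=> [z Wz|v].
  apply: (differentiable_comp (f := fun z => (z, c))); last exact: fd.
  by apply: differentiable_pair.
suff -> : (fun z => 'D_v (fun z => f (z, c)) z) =
    (fun z => (fun y => 'D_((v, 0) : E * F) f y) (z, c))
  by exact: (IH _ (fv (v, 0))).
apply/funext => z; rewrite /derive; set G1 := (X in X @ _).
set G2 := (X in _ = lim (X @ _)).
suff -> : G1 = G2 by [].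
rewrite {}/G1 {}/G2; apply/funext => h /=; congr (_ *: (f _ - _)).
by rewrite -[RHS]/(h *: v + z, h *: 0 + c) scaler0 add0r.
Qed.

(** Freezing the matrix argument turns a trivialization into a local section, and the action into a
    right translation. *)
Lemma smooth_at_pairl E F G (M : charted E) (Q : charted G)
  (f : prodc M (vec F) -> Q) x (c : vec F) : smooth_at f (x, c) ->
  smooth_at (fun y => f (y, c)) x.
Proof.
move=> [fc [W [oW Wx fW]]]; split.
  apply: (@continuous_comp _ _ _ (fun y => (y, c)) f) => //.
  exact: pairl_continuous.
exists [set z | W (z, c)]; split=> //; last first.
  by move=> k; exact: (@Ck_on_pairl _ _ _ _ _ _ c oW (fW k)).
apply: (@open_comp _ _ (fun z : E => (z, c))) oW => z _.
exact: pairl_continuous.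
Qed.

End Charts.

(** Continuity of f at y is recovered from its expression, since f is [par k] after [lexp i k f]
    after [coord i] near y. Smoothness of a local section at one point thus yields its
    differentiability at all nearby points. *)
Lemma lexp_mdiff {R : realType} {E F : normedModType R} {M : charted E}
  {N : charted F} (hM : is_manifold M) (hN : is_manifold N) (i : chart M)
  (k : chart N) (f : M -> N) (W : set E) y : open W ->
  (forall z, W z -> dom k (f (par i z))) ->
  (forall z, W z -> differentiable (lexp i k f) z) ->
  dom i y -> W (coord i y) -> mdiff f y.
Proof.
move=> oW Wk fW yi Wy.
have fy : dom k (f y) by rewrite -(mfd_coordK hM yi); exact: Wk.
have Wn : \forall z \near y, W (coord i z).
  exact: (mfd_coord_cont hM yi (open_nbhs_nbhs (conj oW Wy))).
apply: (mdiff_lexp hM hN yi fy); last exact: fW.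
have e : \forall z \near y, (par k \o (lexp i k f \o coord i)) z = f z.
  apply: filterS2 Wn (open_near (mfd_dom_open hM i) yi (fun _ h => h)) => z Wz zi.
  have := Wk _ Wz; rewrite /lexp /= (mfd_coordK hM zi) => zk.
  by rewrite (mfd_coordK hN zk).
suff : f @ y --> (par k \o (lexp i k f \o coord i)) y.
  by rewrite (nbhs_singleton e).
have c : {for y, continuous (par k \o (lexp i k f \o coord i) : M -> N)}.
  apply: continuous_comp.
    apply: continuous_comp; first exact: mfd_coord_cont.
    by apply: differentiable_continuous; exact: fW.
  rewrite /= /lexp /= (mfd_coordK hM yi).
  exact: mfd_par_cont.
by apply: cvg_trans c; exact: near_eq_cvg.
Qed.

(** * The Lorentzian model *)

Section MatrixCurves.
Context {R : realType} {V : normedModType R}.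

Lemma is_derive_mxP m n (M : V -> 'M[R]_(m, n)) (dM : 'M[R]_(m, n)) t v :
  is_derive t v M dM <-> forall i j, is_derive t v (fun s => M s i j) (dM i j).
Proof.
split=> [[Md <-] i j|Mij].
  by split; [move/derivable_mxP : Md|rewrite derive_mx // mxE].
have Md : derivable M t v by apply/derivable_mxP => i j; have [] := Mij i j.
split=> //; rewrite derive_mx //; apply/matrixP => i j; rewrite mxE.
by have [] := Mij i j.
Qed.

Lemma is_derive_mulmxl (m k n : nat) (B : 'M[R]_(m, k))
  (M : V -> 'M[R]_(k, n)) t v dM :
  is_derive t v M dM -> is_derive t v (fun s => B *m M s) (B *m dM).
Proof.
move/is_derive_mxP => Md; apply/is_derive_mxP => i j.
have -> : (fun s => (B *m M s) i j) =
    \sum_(l < k) (B i l \*: (fun s => M s l j)).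
  by apply/funext => s; rewrite mxE fct_sumE.
rewrite mxE; apply: is_derive_sum => l.
Qed.

Lemma is_derive_mulmxr (m k n : nat) (B : 'M[R]_(k, n))
  (M : V -> 'M[R]_(m, k)) t v dM :
  is_derive t v M dM -> is_derive t v (fun s => M s *m B) (dM *m B).
Proof.
move=> /is_derive_mxP Md; have MT : is_derive t v (fun s => (M s)^T) dM^T.
  apply/is_derive_mxP => i j; rewrite mxE.
  by have := Md j i; congr is_derive; apply/funext => s; rewrite mxE.
have /is_derive_mxP MB := is_derive_mulmxl B^T MT.
apply/is_derive_mxP => i j; have := MB j i.
rewrite -trmx_mul mxE; congr is_derive; apply/funext => s.
by rewrite -trmx_mul mxE.
Qed.

End MatrixCurves.

Section Lorentz.
Context {R : realType} {m : nat}.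
Implicit Types (v w : 'cV[R]_m.+2) (A X : 'M[R]_m.+2).

Definition lor_mx : 'M[R]_m.+2 :=
  diag_mx (\row_i (if i == ord_max then -1 else 1)).

Lemma lor_mxE v w : (lor v w)%:M = v^T *m lor_mx *m w.
Proof.
apply/matrixP => i j; rewrite !ord1 [RHS]mxE [LHS]mxE eqxx mulr1n.
under eq_bigr do rewrite /lor_mx mul_mx_diag !mxE.
rewrite big_ord_recr /= eqxx mulrN1 mulNr; congr (_ - _).
apply: eq_bigr => k _.
have -> : lift ord_max k = widen_ord (leqnSn m.+1) k.
  by apply: val_inj; rewrite /= /bump leqNgt ltn_ord.
by rewrite -val_eqE /= (ltn_eqF (ltn_ord k)) mulr1.
Qed.

Lemma lorE v w : lor v w = (v^T *m lor_mx *m w) 0 0.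
Proof. by rewrite -lor_mxE mxE eqxx mulr1n. Qed.

Lemma lorC v w : lor v w = lor w v.
Proof.
by rewrite /lor mulrC; congr (_ - _); apply: eq_bigr => i _; rewrite mulrC.
Qed.

Lemma lor_is_linear v : linear (lor v).
Proof. by move=> a w w'; rewrite !lorE linearP /= !mxE. Qed.

HB.instance Definition _ v :=
  GRing.isLinear.Build R 'cV[R]_m.+2 R *%R (lor v) (lor_is_linear v).

Lemma lorDl v v' w : lor (v + v') w = lor v w + lor v' w.
Proof. by rewrite lorC linearD /= !(lorC w). Qed.

Lemma lorZl a v w : lor (a *: v) w = a * lor v w.
Proof. by rewrite lorC linearZ /= (lorC w). Qed.

Lemma lorBl v v' w : lor (v - v') w = lor v w - lor v' w.
Proof. by rewrite lorC linearB /= !(lorC w). Qed.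

Lemma lor_suml I (r : seq I) (P : pred I) (f : I -> 'cV[R]_m.+2) w :
  lor (\sum_(i <- r | P i) f i) w = \sum_(i <- r | P i) lor (f i) w.
Proof. by rewrite lorC linear_sum; apply: eq_bigr => i _; rewrite lorC. Qed.

(** The witness is the rank-two skew map sending v to lor n v times w minus lor w v times n. *)
Lemma lieG_transitive ell n w : lor ell n = 1 -> lor ell w = 0 ->
  exists2 A, lieG A & A *m ell = w.
Proof.
move=> ln lw; pose A := w *m (n^T *m lor_mx) - n *m (w^T *m lor_mx).
have AE v : A *m v = lor n v *: w - lor w v *: n.
  by rewrite mulmxBl -!(mulmxA _ (_ *m _) v) -!lor_mxE !mul_mx_scalar.
exists A => [v v'|]; last by rewrite AE lorC ln scale1r lorC lw scale0r subr0.
rewrite !AE lorBl !lorZl linearB /= !linearZ /= (lorC v w) (lorC v n).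
by rewrite /GRing.scale /=; ring.
Qed.

(** * Coordinates in an adapted basis *)

Section AdaptedBasis.
Variables (ell : 'cV[R]_m.+2) (e : 'I_m -> 'cV[R]_m.+2) (n : 'cV[R]_m.+2).
Hypothesis basis : adapted_basis ell e n.

(** The family (ell, e_1, ..., e_m, n) indexed by one ordinal, so that it can be stacked into a
    square matrix. *)
Let b (i : 'I_m.+2) : 'cV[R]_m.+2 :=
  if unlift ord_max i is Some j then
    if unlift ord0 j is Some k then e k else ell
  else n.

Lemma adapted_basis_sumE (c : 'I_m.+2 -> R) :
  \sum_i c i *: b i = c ord_max *: n + (c (lift ord_max ord0) *: ell +
    \sum_k c (lift ord_max (lift ord0 k)) *: e k).
Proof.
rewrite (bigD1_ord ord_max) //= (bigD1_ord ord0) //= /b unlift_none liftK.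
rewrite unlift_none; congr (_ + (_ + _)); apply: eq_bigr => k _.
by rewrite !liftK.
Qed.

(** Since ell and n are null with product 1, the product with ell reads the coefficient of n, and
    conversely. *)
Lemma lor_adapted (a1 a2 : R) (a : 'I_m -> R) v :
  v = a2 *: n + (a1 *: ell + \sum_k a k *: e k) ->
  [/\ lor v ell = a2, lor v n = a1 & forall k, lor v (e k) = a k].
Proof.
have [[ll _] ln nn le ee] := basis.
have sum0 w : (forall k, lor w (e k) = 0) -> lor (\sum_k a k *: e k) w = 0.
  by move=> we; rewrite lor_suml big1 // => k _; rewrite lorZl lorC we mulr0.
move=> ->; split=> [||k]; rewrite !lorDl !lorZl.
- by rewrite ll lorC ln sum0 ?mulr1 ?mulr0 ?addr0 // => k; have [] := le k.
- by rewrite nn ln sum0 ?mulr1 ?mulr0 ?addr0 ?add0r // => k; have [] := le k.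
- have [-> ->] := le k; rewrite !mulr0 !add0r.
  rewrite lor_suml (bigD1 k) //= lorZl ee eqxx.
  rewrite mulr1 big1 ?addr0 // => j jk.
  by rewrite lorZl ee (negbTE jk) mulr0.
Qed.

(** That the basis spans is not part of [adapted_basis]. By [lor_adapted] a vanishing combination
    has zero coefficients, so the matrix B with these vectors as rows is invertible; the
    coefficients of v are then read off by the same lemma. *)
Lemma adapted_decomp v :
  v = lor v ell *: n + (lor v n *: ell + \sum_k lor v (e k) *: e k).
Proof.
pose B : 'M[R]_m.+2 := \matrix_(i, j) b i j 0.
have BE (u : 'rV[R]_m.+2) : (u *m B)^T = \sum_i u 0 i *: b i.
  apply/colP => j; rewrite !mxE summxE; apply: eq_bigr => i _.
  by rewrite !mxE.
have BU : B \in unitmx.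
  rewrite unitmxE unitfE; apply/det0P => -[u u0 uB]; case/eqP: u0.
  have := BE u; rewrite uB trmx0 adapted_basis_sumE => /lor_adapted[].
  have z w : lor 0 w = 0 by rewrite lorC linear0.
  rewrite !z => c2 c1 ck; apply/rowP => i; rewrite [RHS]mxE.
  case: (unliftP ord_max i) => [j ->|-> //].
  by case: (unliftP ord0 j) => [k ->|-> //]; rewrite -ck z.
have := BE (v^T *m invmx B); rewrite mulmxKV // trmxK adapted_basis_sumE.
move=> vE; have [-> -> ek] := lor_adapted vE.
rewrite {1}vE; congr (_ + (_ + _)).
by apply: eq_bigr => k _; rewrite ek.
Qed.

(** Orthogonality of v to ell removes its n-component, and that of w to ell makes the ell-component
    of v invisible. What remains is the Euclidean product that [qform] takes on g/h. *)
Lemma lor_adapted_perp v w : lor v ell = 0 ->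
  lor w ell = 0 -> lor v w = \sum_k lor v (e k) * lor w (e k).
Proof.
have [[ll _] ln nn le ee] := basis => vl wl.
rewrite {1}(adapted_decomp v) vl scale0r add0r lorDl lorZl.
rewrite (lorC ell) wl mulr0 add0r.
by rewrite lor_suml; apply: eq_bigr => k _; rewrite lorZl (lorC (e k)).
Qed.

End AdaptedBasis.


Lemma is_derive_lor (p q : R -> 'cV[R]_m.+2) (t : R) dp dq :
  is_derive t 1 p dp -> is_derive t 1 q dq ->
  is_derive t 1 (fun s => lor (p s) (q s)) (lor dp (q t) + lor (p t) dq).
Proof.
move=> p' q'; move/is_derive_mxP: p' => p'; move/is_derive_mxP: q' => q'.
have M i : is_derive t 1 ((fun s => p s i 0) * (fun s => q s i 0))
    (p t i 0 *: dq i 0 + q t i 0 *: dp i 0).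
  by have := p' i 0; have := q' i 0 => *; exact: is_deriveM.
have -> : (fun s => lor (p s) (q s)) =
    \sum_(i < m.+1) ((fun s => p s (lift ord_max i) 0) *
      (fun s => q s (lift ord_max i) 0)) -
    (fun s => p s ord_max 0) * (fun s => q s ord_max 0).
  by apply/funext => s; rewrite /lor -[RHS]/((_ - _) s) /= fct_sumE.
apply: is_derive_eq.
rewrite /lor addrACA -opprD -big_split /=; congr (_ - _).
  by apply: eq_bigr => i _; rewrite addrC [_ * q _ _ _]mulrC.
by rewrite addrC [_ * q _ _ _]mulrC.
Qed.

(** Differentiate at 0 the constants [lor (gamma t *m v) (gamma t *m w)] and [gamma t *m ell]. The
    result is what [omega_fundamental] demands of X. *)
Lemma lieH_velocity ell (gamma : R -> 'M[R]_m.+2) X : gamma 0 = 1%:M ->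
  (\forall t \near 0, groupH ell (gamma t)) ->
  is_derive (0 : R) (1 : R) gamma X -> lieH ell X.
Proof.
move=> g0 gH gX; split=> [v w|].
  have := is_derive_lor (is_derive_mulmxr v gX) (is_derive_mulmxr w gX).
  rewrite g0 !mul1mx => -[_ <-].
  rewrite (@near_eq_derive _ _ _ _ (cst (lor v w))) ?derive_cst //.
  by apply: filterS gH => t [[gi _] _]; exact: gi.
have [_ <-] := is_derive_mulmxr ell gX.
rewrite (@near_eq_derive _ _ _ _ (cst ell)) ?derive_cst //.
by apply: filterS gH => t [].
Qed.

End Lorentz.

(** * Principal bundles *)

Lemma eq_tmap_point {R : realType} {E F : normedModType R} {M : charted E}
  {N : charted F} (f : M -> N) (x y : M) (v : E) : x = y ->
  @tmap R E F M N f x v = @tmap R E F M N f y v :> F.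
Proof. by move=> ->. Qed.

Section PrincipalBundle.
Context {R : realType} {E : normedModType R} {k : nat} {H : set 'M[R]_k}.
Context {N : charted E} (P : principal_bundle H N).
Hypotheses (hN : is_manifold N) (H1 : H 1%:M).
Hypotheses (HM : forall g h, H g -> H h -> H (g *m h)).
Hypotheses (HV : forall g, H g -> H (invmx g)).
Hypotheses (HU : forall g, H g -> g \in unitmx).
Implicit Types (u : P) (x : N).

Lemma bproj_surj x : exists u, bproj u = x.
Proof.
have [U [psi [kappa [oU Ux [piE _ _ _ _]]]]] := btrivial P x.
by exists (psi (x, 1%:M)); have [] := piE x 1%:M Ux H1.
Qed.

(** Transitivity and freeness on fibres are not clauses of [principal_bundle]; both are read in a
    trivialization, where the action is right multiplication on the H-coordinate. *)
Lemma bact_transitive u u' : bproj u = bproj u' ->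
  exists2 h, H h & u' = bact u h.
Proof.
have [U [psi [kappa [oU Ux [_ uE aE _ _]]]]] := btrivial P (bproj u).
move=> uu'; have [Hu uE1] := uE u Ux.
have [Hu' uE2] : H (kappa u') /\ psi (bproj u', kappa u') = u'.
  by apply: uE; rewrite -uu'.
have Hg : H (invmx (kappa u) *m kappa u') by apply: HM; [exact: HV|].
exists (invmx (kappa u) *m kappa u') => //.
have e : kappa u *m (invmx (kappa u) *m kappa u') = kappa u'.
  by rewrite mulKVmx ?HU.
by rewrite -{1}uE1 aE // -{1}uE2 uu'; congr (psi (_, _)).
Qed.

Lemma bact_free u h : H h -> bact u h = u -> h = 1%:M.
Proof.
have [U [psi [kappa [oU Ux [pE uE aE _ _]]]]] := btrivial P (bproj u).
move=> Hh hu; have [Hu uE1] := uE u Ux.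
have := aE _ _ _ Ux Hu Hh; rewrite uE1 hu => uh.
have [_] := pE _ _ Ux (HM Hu Hh); rewrite -uh => uhE.
by rewrite -[LHS](mulKmx (HU Hu)) -uhE mulVmx ?HU.
Qed.

Lemma bundle_chart u : chart_around (chart_at u) u.
Proof.
have hP := total_manifold P.
exact: (manifold_chart_around hP (mfd_cover hP u)).
Qed.

Lemma base_chart x : chart_around (chart_at x) x.
Proof. exact: manifold_chart_around hN (mfd_cover hN x). Qed.

Lemma mdiff_bproj u : mdiff (@bproj _ _ _ _ _ P) u.
Proof. exact: smooth_at_mdiff (bproj_smooth u). Qed.

(** The section is [psi] with its matrix argument frozen at [kappa u], so that it passes through u;
    a smooth extension of [psi] stands in for it. *)
Lemma local_section u : exists s : N -> P,
  [/\ smooth_at s (bproj u), s (bproj u) = u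
    & \forall y \near bproj u, bproj (s y) = y].
Proof.
have [U [psi [kappa [oU Ux [pE uE aE psiS _]]]]] := btrivial P (bproj u).
have [Hu uE1] := uE u Ux.
have [g [gS gE]] := psiS (bproj u, kappa u) (conj Ux Hu).
exists (fun y => g (y, kappa u)); split; first exact: smooth_at_pairl gS.
  by rewrite (nbhs_singleton gE) //=.
have Un : \forall y \near bproj u, U y by exact: (open_near oU Ux).
have gn := @pairl_continuous _ _ (kappa u : vec 'M[R]_k) (bproj u) _ gE.
apply: filterS2 Un gn => y Uy /= ->; last by [].
by have [] := pE y (kappa u) Uy Hu.
Qed.

Lemma mdiff_bact u h : H h -> mdiff (fun u' : P => bact u' h) u.
Proof.
move=> Hh; have [g [gS gE]] := bact_smooth (p := P) (x := (u, h)) Hh.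
have gn : \forall v \near u, g (v, h) = bact v h.
  have gn : \forall v \near u, H h -> g (v, h) = bact v h.
    exact: @pairl_continuous _ _ (h : vec 'M[R]_k) u _ gE.
  by apply: filterS gn => v ->.
have gD := smooth_at_mdiff (smooth_at_pairl gS).
by have [] := near_eq_mdiff (bundle_chart u) gn gD.
Qed.

Lemma tmap_bproj_bact u h (eta : tangent u) : H h ->
  tmap (@bproj _ _ _ _ _ P) (tmap (fun u' : P => bact u' h) eta) =
  tmap (@bproj _ _ _ _ _ P) eta :> E.
Proof.
move=> Hh; have [_ <-] := mdiff_comp (bundle_chart u) (bundle_chart _)
  (mdiff_bact u Hh) (mdiff_bproj _).
suff -> : (@bproj _ _ _ _ _ P \o fun u' : P => bact u' h) =
  @bproj _ _ _ _ _ P by [].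
by apply/funext => u' /=; rewrite bact_fiber.
Qed.

Lemma tmap_section (s : N -> P) x (W : tangent x) : mdiff s x ->
  (\forall y \near x, bproj (s y) = y) ->
  tmap (@bproj _ _ _ _ _ P) (tmap s W) = W :> E.
Proof.
move=> sD sE; have [D <-] :=
  mdiff_comp (base_chart x) (bundle_chart _) sD (mdiff_bproj _).
have [_ ->] := near_eq_mdiff (base_chart x) sE D.
by have [_ ->] := mdiff_id x hN.
Qed.

Lemma tmap_bproj_surj u (W : E) : exists eta : tangent u,
  tmap (@bproj _ _ _ _ _ P) eta = W.
Proof.
have [s [sS su sE]] := local_section u.
have := tmap_section (W : tangent (bproj u)) (smooth_at_mdiff sS) sE.
move: (tmap s _ : 'rV[R]_(bdim P)) => eta; rewrite su => eE.
by exists eta.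
Qed.

(* Differentiating [v = psi (pi v, kappa v)] at [u], a vertical vector is the
   velocity of [t |-> psi (pi u, kappa (c t))], for any curve [c] with
   velocity [eta]. *)
Lemma vertical_velocity u (eta : tangent u) :
  tmap (@bproj _ _ _ _ _ P) eta = 0 ->
  exists (gamma : R -> 'M[R]_k) (X : 'M[R]_k),
    [/\ gamma 0 = 1%:M, \forall t \near 0, H (gamma t),
        is_derive (0 : R) (1 : R) gamma X
      & @tmap R R _ (vec R) P (fun t => bact u (gamma t)) 0 1 = eta
          :> 'rV[R]_(bdim P)].
Proof.
move=> eta0.
have [U [psi [kappa [oU Ux [pE uE aE psiS kS]]]]] := btrivial P (bproj u).
have [Hu uE1] := uE u Ux.
have [g [gS gE]] := psiS (bproj u, kappa u) (conj Ux Hu).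
have [ka [kaS kaE]] := kS u Ux.
have kau : ka u = kappa u by exact: (nbhs_singleton kaE).
have [pc _] := mdiff_bproj u.
have Un : \forall v \near u, U (bproj v).
  by apply: pc; exact: (open_near oU Ux).
have kaD := smooth_at_mdiff kaS; have gD := smooth_at_mdiff gS.
have [pairD pairE] := mdiff_pair (mdiff_bproj u) kaD.
set pr : P -> prodc N (vec 'M[R]_k) := fun y => (bproj y, ka y).
have pru : pr u = (bproj u, kappa u) by rewrite /pr kau.
have gD' : mdiff g (pr u) by rewrite pru.
have prod_chart : chart_around (chart_at (pr u)) (pr u).
  by apply: prod_chart_around; [exact: base_chart|exact: vec_chart_around].
have [gpD gpE] := mdiff_comp (bundle_chart u) prod_chart pairD gD'.
(* Near u the extension [ka] equals [kappa], hence takes values in H, where the extension [g] equals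
   [psi]. *)
have gpid : \forall v \near u, (g \o pr) v = v.
  have gn : \forall v \near u, U (bproj v) /\ H (ka v) -> g (pr v) = psi (pr v).
    have gn : nbhs (pr u) [set w | U w.1 /\ H w.2 -> g w = psi w].
      by rewrite pru.
    exact: pairD.1 gn.
  apply: filterS2 Un (filterI kaE gn) => v Uv [kav /(_ _)].
  have [Hv vE] := uE v Uv.
  by move=> /= ->; rewrite /pr kav //.
have etaE : tmap g (tmap pr eta) = eta :> 'rV[R]_(bdim P).
  have [_ idE] := near_eq_mdiff (bundle_chart u) gpid gpD.
  rewrite -gpE idE; have [_ -> //] := mdiff_id u (total_manifold P).
pose kd : 'M[R]_k := tmap ka eta.
have prE : tmap pr eta = (0, kd) :> E * 'M[R]_k by rewrite pairE eta0.
pose z0 := coord (chart_at u) u.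
pose aff (t : R) : 'rV[R]_(bdim P) := z0 + t *: eta.
have aff0 : aff 0 = z0 by rewrite /aff scale0r addr0.
have affD : is_diff (0 : R) aff ( *:%R^~ eta).
  have : is_diff (0 : R) (cst z0 + ( *:%R^~ eta)) (0 + ( *:%R^~ eta)).
    exact: is_diffD.
  by rewrite add0r.
have affC : {for (0 : R), continuous aff}.
  by apply: differentiable_continuous; exact: ex_diff.
pose K : vec R -> vec 'M[R]_k := fun t => ka (par (chart_at u) (aff t)).
have K0 : K 0 = kappa u.
  have [_ /nbhs_singleton parE _ _] := bundle_chart u.
  by rewrite /K aff0 parE.
have kaD0 : differentiable (local_expr ka u) (aff 0).
  by rewrite aff0; exact: kaD.2.
have KD : differentiable (K : R -> 'M[R]_k) (0 : R).
  apply: (@differentiable_comp _ _ _ _ aff (local_expr ka u)) => //.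
have KdE : 'd (K : R -> 'M[R]_k) (0 : R) 1 = kd.
  rewrite (@diff_comp _ _ _ _ aff (local_expr ka u)) //.
  by rewrite /= diff_val scale1r aff0.
have Kd : is_derive (0 : R) (1 : R) (K : R -> 'M[R]_k) kd.
  by split; [exact/derivable1_diffP|rewrite deriveE].
have KC : {for (0 : R), continuous (K : R -> 'M[R]_k)}.
  exact: differentiable_continuous.
(* The factor [invmx (kappa u)] makes the curve start at 1; by equivariance [bact u (gamma t)] is
   then [psi (bproj u, K t)]. *)
pose gamma (t : R) : 'M[R]_k := invmx (kappa u) *m K t.
have KH : \forall t \near (0 : R), H (K t).
  have : \forall z \near aff 0, H (ka (par (chart_at u) z)).
    rewrite aff0.
    apply: (@chart_around_par _ _ _ _ _ (H \o ka) (bundle_chart u)).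
    apply: filterS2 Un kaE => v Uv kav /=; rewrite kav //.
    by have [] := uE v Uv.
  by move=> kH; exact: (affC _ kH).
have gammaH : \forall t \near (0 : R), H (gamma t).
  by apply: filterS KH => t HK; apply: HM => //; exact: HV.
have gamma0 : gamma 0 = 1%:M by rewrite /gamma K0 mulVmx ?HU.
exists gamma, (invmx (kappa u) *m kd); split=> //.
  exact: is_derive_mulmxl.
pose F : vec R -> P := fun t => g (bproj u, K t).
have KM : mdiff K 0 by split.
have [FpD FpE] := mdiff_pair (mdiff_cst (bproj u) (0 : vec R)) KM.
have p0 : (bproj u, K 0) = pr u by rewrite pru K0.
have gDK : mdiff g (bproj u, K 0) by rewrite p0.
pose q0 : prodc N (vec 'M[R]_k) := (bproj u, K 0).
have cK : chart_around (chart_at q0) q0 by rewrite /q0 p0.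
have [FD FE] := mdiff_comp (vec_chart_around _ _) cK FpD gDK.
have Fn : \forall t \near (0 : vec R),
    (g \o (fun t => (bproj u, K t))) t = bact u (gamma t).
  have gn : nbhs (bproj u, K 0) [set w | U w.1 /\ H w.2 -> g w = psi w].
    by rewrite K0.
  have gn' : \forall t \near (0 : R), U (bproj u) /\ H (K t) ->
      g (bproj u, K t) = psi (bproj u, K t).
    exact: FpD.1 gn.
  apply: filterS3 KH gammaH gn' => t HK Hg /= ->; last by [].
  by rewrite -[in RHS]uE1 aE // /gamma mulKVmx ?HU.
have [_ <-] := near_eq_mdiff (vec_chart_around _ _) Fn FD.
rewrite FE FpE.
have -> : @tmap R R E (vec R) N (fun=> bproj u) 0 1 = 0.
  by rewrite /tmap /local_expr (diff_cst (coord (chart_at (bproj u)) (bproj u))).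
have -> : @tmap R R _ (vec R) (vec 'M[R]_k) K 0 1 = kd by exact: KdE.
rewrite -[RHS]etaE prE.
exact: (@eq_tmap_point _ _ _ _ _ g _ _ (0, kd) p0).
Qed.

End PrincipalBundle.

(** * The tractor bundle *)

Lemma groupH_unit {R : realType} {m : nat} (ell : 'cV[R]_m.+2) g :
  groupH ell g -> g \in unitmx.
Proof. by case=> /groupG_unit. Qed.

Section Cartan.
Context {R : realType} {m : nat} {ell : 'cV[R]_m.+2} {N : charted 'rV[R]_m.+1}.
Variables (C : cartan_geometry ell N) (hN : is_manifold N).
Implicit Types (u : C) (v w : 'cV[R]_m.+2).

Let groupHU := @groupH_unit R m ell.

Let HM := @groupHM R m ell.
Let HV := @groupHV R m ell.

Lemma groupH_fix_inv h : groupH ell h -> invmx h *m ell = ell.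
Proof. by move=> /HV[]. Qed.

Lemma lor_groupH h v w : groupH ell h -> lor (h *m v) (h *m w) = lor v w.
Proof. by case=> -[]. Qed.

Lemma eq_omega_point u u' (eta : 'rV[R]_(bdim C)) : u = u' ->
  @omega _ _ _ _ C u eta = @omega _ _ _ _ C u' eta.
Proof. by move=> ->. Qed.

Lemma omega_vertical u (eta : tangent u) :
  tmap (@bproj _ _ _ _ _ C) eta = 0 -> omega eta *m ell = 0.
Proof.
move=> /(vertical_velocity hN HM HV groupHU)[gamma [X [g0 gH gX gE]]].
have XH := lieH_velocity g0 gH gX.
have := omega_fundamental u XH g0 gH gX.
(* The axiom speaks of the point [bact u (gamma 0)], which is equal to u but not convertible to
   it. *)
rewrite gE (@eq_omega_point _ u) ?g0 ?bact1 // => ->.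
by case: XH.
Qed.

Lemma omegaB u (eta eta' : tangent u) :
  omega (eta - eta') = omega eta - omega eta'.
Proof.
have := @omega_linear _ _ _ _ C u (-1) eta' eta.
by rewrite !scaleN1r ![- _ + _]addrC.
Qed.

Lemma tmapB (E F : normedModType R) (M : charted E) (Q : charted F) (f : M -> Q)
  x (v w : tangent x) : tmap f (v - w) = tmap f v - tmap f w.
Proof. exact: linearB. Qed.

Lemma omega_ell_eq u (eta eta' : tangent u) :
  tmap (@bproj _ _ _ _ _ C) eta = tmap (@bproj _ _ _ _ _ C) eta' ->
  omega eta *m ell = omega eta' *m ell.
Proof.
move=> e; apply/eqP; rewrite -subr_eq0 -mulmxBl -omegaB; apply/eqP.
by apply: omega_vertical; rewrite tmapB e subrr.
Qed.

Lemma tclassP u u' v v' : tclass u v = tclass u' v' <->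
  exists2 h, groupH ell h & u' = bact u h /\ v' = invmx h *m v.
Proof.
split=> [/eqmodP/asboolP[h Hh [-> ->]]|[h Hh [-> ->]]]; first by exists h.
by apply/eqmodP/asboolP; exists h.
Qed.

Lemma tclass_inj u : injective (tclass u).
Proof.
move=> v w /tclassP[h Hh [hu ->]].
by rewrite (bact_free HM groupHU Hh (esym hu)) invmx1 mul1mx.
Qed.

Lemma tclass_ell u u' : bproj u = bproj u' -> tclass u ell = tclass u' ell.
Proof.
move=> /(bact_transitive HM HV groupHU)[h Hh ->]; apply/tclassP.
by exists h; rewrite // groupH_fix_inv.
Qed.

(* [omega eta *m ell] only sees the class of [omega eta] in g/h, and passing
   from [u] to [bact u h] multiplies it by [invmx h]. *)
Lemma tclass_omega u u' (eta : tangent u) (eta' : tangent u') :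
  bproj u = bproj u' ->
  tmap (@bproj _ _ _ _ _ C) eta = tmap (@bproj _ _ _ _ _ C) eta' :> 'rV_m.+1 ->
  tclass u (omega eta *m ell) = tclass u' (omega eta' *m ell).
Proof.
move=> /(bact_transitive HM HV groupHU)[h Hh u'E]; subst u' => e.
apply/tclassP; exists h => //; split=> //.
pose eta1 : tangent (bact u h) := tmap (fun u' : C => bact u' h) eta.
rewrite -(@omega_ell_eq _ eta1 eta').
  by rewrite /eta1 omega_equiv // -!mulmxA (proj2 Hh).
by rewrite -e; exact: tmap_bproj_bact.
Qed.

Lemma tclass_repr (t : tractor C) : tclass (repr t).1 (repr t).2 = t.
Proof. by rewrite /tclass -surjective_pairing reprK. Qed.

Lemma tproj_class u v : tproj (tclass u v) = bproj u.
Proof.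
have /tclassP[h Hh [e _]] := tclass_repr (tclass u v).
by rewrite [in RHS]e bact_fiber.
Qed.

Lemma tclass_bact u v h : groupH ell h ->
  tclass u v = tclass (bact u h) (invmx h *m v).
Proof. by move=> Hh; apply/tclassP; exists h. Qed.

Lemma tcoord_class u v : tcoord u (tclass u v) = v.
Proof.
apply: (@tclass_inj u); rewrite /tcoord.
by case: xgetP => [w _ /= <- //|/(_ v) []].
Qed.

(** The fibrewise operations are computed at the point of the bundle stored in [repr], of which only
    its H-orbit is known. Moving every class to that point multiplies all vectors by the same
    [invmx h], an isometry. *)
Lemma repr_class u v :
  exists2 h, groupH ell h & (repr (tclass u v)).1 = bact u h.
Proof.
have /esym/tclassP[h Hh [e _]] := tclass_repr (tclass u v).
by exists h.
Qed.

Lemma tmetric_class u v w : tmetric (tclass u v) (tclass u w) = lor v w.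
Proof.
rewrite /tmetric; have [h Hh ->] := repr_class u v.
by rewrite (tclass_bact u v Hh) (tclass_bact u w Hh) !tcoord_class
  lor_groupH //; exact: HV.
Qed.

Lemma tadd_class u v w : tadd (tclass u v) (tclass u w) = tclass u (v + w).
Proof.
rewrite /tadd; have [h Hh ->] := repr_class u v.
by rewrite (tclass_bact u v Hh) (tclass_bact u w Hh) !tcoord_class
  -mulmxDr -tclass_bact.
Qed.

Lemma tscale_class a u v : tscale a (tclass u v) = tclass u (a *: v).
Proof.
rewrite /tscale; have [h Hh ->] := repr_class u v.
by rewrite (tclass_bact u v Hh) tcoord_class scalemxAr -tclass_bact.
Qed.

End Cartan.

(** * The vectors omega eta ell and the structure induced on the base *)

Section Tractor.
Context {R : realType} {m : nat} {ell : 'cV[R]_m.+2} {N : charted 'rV[R]_m.+1}.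
Variables (C : cartan_geometry ell N) (hN : is_manifold N).
Variables (e : 'I_m -> 'cV[R]_m.+2) (n : 'cV[R]_m.+2).
Hypothesis basis : adapted_basis ell e n.
Implicit Types (u : C) (v w : 'cV[R]_m.+2).

Let groupHU := @groupH_unit R m ell.

Let H1 := groupH1 ell.
Let HM := @groupHM R m ell.
Let HV := @groupHV R m ell.

Local Notation pr := (@bproj _ _ _ _ _ C).

Lemma omega_ell_perp u (eta : tangent u) : lor (omega eta *m ell) ell = 0.
Proof.
have : lieG (omega eta) by rewrite -(omega_range u); exists eta.
move=> /(_ ell ell); rewrite [X in _ + X]lorC -mulr2n => /eqP.
by rewrite mulrn_eq0 /= => /eqP.
Qed.

Lemma omega_ell_surj u w : lor ell w = 0 ->
  exists eta : tangent u, omega eta *m ell = w.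
Proof.
have [_ ln _ _ _] := basis => /(lieG_transitive ln)[A AG Aw].
have : range (@omega _ _ _ _ C u) A by rewrite omega_range.
by case=> eta _ etaA; exists eta; rewrite etaA.
Qed.

(** Let [et j] be tangent vectors at u for which omega applied to ell gives the basis [b] = (ell,
    e_1, ..., e_m) of the orthogonal of ell. Their m+1 projections to the base are independent: a
    combination projecting to 0 is vertical, so the same combination of [b] vanishes. Hence any eta
    has the projection of some combination of the [et j], with coefficients c, and its omega sends
    ell to the combination of [b] with these coefficients; if that is 0, so is c. *)
Lemma omega_ell_inj u (eta : tangent u) :
  omega eta *m ell = 0 -> tmap pr eta = 0.
Proof.
move=> eta0; have [[ll _] ln nn le ee] := basis.
pose b (j : 'I_m.+1) := if unlift ord0 j is Some k then e k else ell.
have bE (c : 'rV[R]_m.+1) : \sum_j c 0 j *: b j =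
    0 *: n + (c 0 ord0 *: ell + \sum_k c 0 (lift ord0 k) *: e k).
  rewrite scale0r add0r (bigD1_ord ord0) //= /b unlift_none; congr (_ + _).
  by apply: eq_bigr => k _; rewrite liftK.
have b0 (c : 'rV[R]_m.+1) : \sum_j c 0 j *: b j = 0 -> c = 0.
  move=> c0; have := bE c; rewrite c0 => /(lor_adapted basis)[_ c1 ck].
  have z w : lor 0 w = 0 by rewrite lorC linear0.
  apply/rowP => j; rewrite mxE; case: (unliftP ord0 j) => [k ->|->].
    by rewrite -ck z.
  by rewrite -c1 z.
have /choice[et etE] j : exists eta : tangent u, omega eta *m ell = b j.
  apply: omega_ell_surj; rewrite /b.
  by case: (unlift ord0 j) => [k|]; [have [] := le k|].
pose om : {linear 'rV[R]_(bdim C) -> 'M[R]_m.+2} :=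
  HB.pack (@omega _ _ _ _ C u)
    (GRing.isLinear.Build _ _ _ _ _ (@omega_linear _ _ _ _ C u)).
pose B : 'M[R]_m.+1 := \matrix_j tmap pr (et j).
pose lc (c : 'rV[R]_m.+1) : tangent u := \sum_j c 0 j *: et j.
have prlc c : tmap pr (lc c) = c *m B.
  rewrite /tmap linear_sum mulmx_sum_row; apply: eq_bigr => j _.
  by rewrite linearZ rowK.
have omlc c : omega (lc c) *m ell = \sum_j c 0 j *: b j.
  rewrite -[omega _]/(om _) linear_sum mulmx_suml; apply: eq_bigr => j _.
  by rewrite linearZ /= -scalemxAl etE.
have BU : B \in unitmx.
  rewrite unitmxE unitfE; apply/det0P => -[c c0 cB]; case/eqP: c0; apply: b0.
  rewrite -omlc; apply: (omega_vertical hN).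
  by rewrite prlc cB.
pose c := (tmap pr eta : 'rV[R]_m.+1) *m invmx B.
have prc : tmap pr (lc c) = tmap pr eta by rewrite prlc mulmxKV.
have := omega_ell_eq hN prc; rewrite omlc eta0 => /b0 c0.
by rewrite -prc prlc c0 mul0mx.
Qed.

(** [mod_h] sees A only through A ell, which is the same for all lifts of a vector; eta itself is a
    candidate, so the default is excluded. *)
Lemma phiE u (eta : tangent u) :
  phi e n (tmap pr eta) = mod_h ell e n (omega eta).
Proof.
rewrite /phi; case: xgetP => [w _ [eta' [/(omega_ell_eq hN) ee ->]]|].
  by rewrite /mod_h ee.
by move=> /(_ (mod_h ell e n (omega eta)))[]; exists eta.
Qed.

Lemma qform_mod_h u (eta eta' : tangent u) :
  qform (mod_h ell e n (omega eta)) (mod_h ell e n (omega eta')) =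
  lor (omega eta *m ell) (omega eta' *m ell).
Proof.
rewrite (lor_adapted_perp basis) ?omega_ell_perp // /qform mxE.
by apply: eq_bigr => k _; rewrite !mxE.
Qed.

Lemma mod_h_radical u (eta : tangent u) :
  mod_h ell e n (omega eta) = (1, 0) <-> omega eta *m ell = ell.
Proof.
have [[ll _] ln nn le ee] := basis; split=> [[n1 e0]|E]; last first.
  rewrite /mod_h E ln; congr (_, _); apply/colP => k.
  by rewrite !mxE; have [] := le k.
rewrite [LHS](adapted_decomp basis) omega_ell_perp n1 scale0r add0r scale1r.
rewrite big1 ?addr0 // => k _.
by move/colP: e0 => /(_ k); rewrite !mxE => ->; rewrite scale0r.
Qed.

Lemma tmap_pr_surj u (W : 'rV[R]_m.+1) :
  exists eta : tangent u, tmap pr eta = W.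
Proof. exact: (tmap_bproj_surj hN). Qed.

(** * The canonical section and its covariant derivative *)

Section CanonicalSection.
Variable xi : N -> tractor C.
Hypothesis xiE : forall u, xi (bproj u) = tclass u ell.

Lemma xi_local_rep x s : smooth_at s x -> (\forall y \near x, pr (s y) = y) ->
  local_rep xi x s (fun=> ell).
Proof.
move=> sS sE; split=> //; first exact: smooth_at_cst.
by apply: filterS sE => y yE; rewrite -{1}yE xiE.
Qed.

Lemma xi_smooth_section : smooth_section xi.
Proof.
split=> [x|x _]; have [u <-] := bproj_surj C H1 x.
  by rewrite xiE tproj_class.
have [s [sS su sE]] := local_section u.
by exists s, (fun=> ell); exact: xi_local_rep.
Qed.

(** Whatever local expression [s, f] is selected by [nabla], injectivity of [tclass (s y)] forces f
    to be ell near x, so its derivative vanishes; [tmap s W] and eta are then two lifts of W. A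
    local section provides an expression, so the default does not occur. *)
Lemma nabla_xi x (W : tangent x) u (eta : tangent u) : bproj u = x ->
  tmap pr eta = W :> 'rV[R]_m.+1 -> nabla xi W = tclass u (omega eta *m ell).
Proof.
move=> ux etaW; rewrite /nabla; case: xgetP.
  move=> t _ [s [f [[sS fS sE fE] ->]]].
  have sx := nbhs_singleton sE.
  have fell : \forall y \near x, ell = f y.
    apply: filterS2 sE fE => y yE; rewrite -{1}yE xiE.
    exact: tclass_inj.
  have [_ tf] := @near_eq_mdiff _ _ _ N (vec _) (fun=> ell) f x
    (base_chart hN x) fell (mdiff_cst (ell : vec _) x).
  rewrite -tf -(nbhs_singleton fell).
  have -> : tmap (fun=> ell : vec 'cV[R]_m.+2) W = 0.
    by rewrite /tmap /local_expr (diff_cst ell).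
  rewrite add0r; apply: (tclass_omega hN); first by rewrite sx.
  by rewrite etaW; exact: (tmap_section hN W (smooth_at_mdiff sS) sE).
subst x; have [s [sS su sE]] := local_section u.
move=> /(_ (tclass (s (bproj u))
  (tmap (fun=> ell : vec 'cV[R]_m.+2) W + omega (tmap s W) *m ell)))[].
by exists s, (fun=> ell); split=> //; exact: xi_local_rep.
Qed.

(** In charts [i] at x and [k] at s x, with S the expression of s, the image under s of the
    coordinate field v has components ['D_v S] in the frame of [k]. Pairing them with omega on that
    frame, smooth by [omega_smooth], and applying the result to ell gives [G], the second half of a
    local expression [s, f]. *)
Lemma nabla_xi_smooth (i : chart N) (v : 'rV[R]_m.+1) :
  smooth_on_tractor (dom i) (fun y => nabla xi (coord_field i v y)).
Proof.
have hP := total_manifold C.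
move=> x xU; have [u ux] := bproj_surj C H1 x.
have [s [sS su sE]] := local_section u; rewrite ux in sS su sE.
set k := chart_at (s x); have sk : dom k (s x) by exact: mfd_cover.
have [W [oW Wx WI Wk sW]] := smooth_at_chart hN hP xU sk sS.
pose S := lexp i k s.
have SD z : W z -> differentiable S z by have [d _] := sW 1; exact: d.
pose Om a z : 'M[R]_m.+2 :=
  @omega _ _ _ _ C (par k z) (coord_field k (delta_mx 0 a) (par k z)).
pose G z : 'cV[R]_m.+2 := \sum_a ('D_v S z) 0 a *: (Om a (S z) *m ell).
have GS : Cinfty_on W G.
  move=> q; apply: Ck_on_sum => // a; apply: Ck_onZ => //.
    by have [_ /(_ v)] := sW q.+1; move/(Ck_on_mxP _ _ oW); apply.
  apply: Ck_on_mulmxr => //.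
  apply: (Ck_on_comp_mx oW (mfd_img_open hP k)); last exact: omega_smooth.
    move=> z Wz; exists (s (par i z)); first exact: Wk.
    by [].
  exact: sW.
pose f : N -> vec 'cV[R]_m.+2 := fun y => G (coord i y).
exists s, f; split=> //.
  apply: (smooth_at_vec hN xU oW Wx) => q.
  have ciK z : W z -> z = coord i (par i z).
    by move=> /WI[y yi <-]; rewrite mfd_coordK.
  refine (@Ck_on_ext R _ _ q W G _ oW _ (GS q)) => z Wz.
  exact: (congr1 G (ciK z Wz)).
have Wn : \forall y \near x, W (coord i y).
  exact: (mfd_coord_cont hN xU (open_nbhs_nbhs (conj oW Wx))).
(* [tmap_section] at a nearby y needs s to be a section on a whole neighbourhood of y, not only at
   y. *)
have sEE : \forall y \near x, \forall z \near y, pr (s z) = z.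
  exact: nbhs_interior sE.
apply: filterS3 Wn (open_near (mfd_dom_open hN i) xU (fun _ h => h)) sEE.
move=> y Wy yi yE; have sy := nbhs_singleton yE.
have sD := lexp_mdiff hN hP oW Wk SD yi Wy.
have syk : dom k (s y) by rewrite -(mfd_coordK hN yi); exact: Wk.
have SE : S (coord i y) = coord k (s y) by rewrite /S /lexp /= mfd_coordK.
rewrite (@nabla_xi _ _ (s y) (tmap s (coord_field i v y))) //; last first.
  exact: (tmap_section hN _ sD yE).
congr tclass; rewrite (tmap_coord_field hN hP v yi syk sD).
rewrite /f /G -(deriveE v (SD _ Wy)).
pose om : {linear 'rV[R]_(bdim C) -> 'M[R]_m.+2} :=
  HB.pack (@omega _ _ _ _ C (s y))
    (GRing.isLinear.Build _ _ _ _ _ (@omega_linear _ _ _ _ C (s y))).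
rewrite -[omega _]/(om _) [X in coord_field _ X]row_sum_delta /coord_field.
rewrite !linear_sum mulmx_suml; apply: eq_bigr => a _.
have -> : Om a (S (coord i y)) = om (coord_field k (delta_mx 0 a) (s y)).
  by rewrite /Om SE (mfd_coordK hP syk).
by rewrite [X in om X *m _]linearZ [X in X *m _]linearZ /= -scalemxAl.
Qed.

Lemma nabla_xi_mono : bundle_monomorphism (nabla xi).
Proof.
split; first (split; last exact: nabla_xi_smooth).
- move=> x v; have [u ux] := bproj_surj C H1 x.
  have [eta etav] := tmap_pr_surj u v.
  by rewrite (nabla_xi ux etav) tproj_class.
- move=> x a v w; have [u ux] := bproj_surj C H1 x.
  have [eta etav] := tmap_pr_surj u v; have [eta' etaw] := tmap_pr_surj u w.
  rewrite (nabla_xi ux etav) (nabla_xi ux etaw) tscale_class tadd_class.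
  rewrite (@nabla_xi _ _ u (a *: eta + eta')) //; last first.
    by rewrite /tmap linearP; congr (_ *: _ + _).
  by rewrite omega_linear mulmxDl -scalemxAl.
- move=> x v w; have [u ux] := bproj_surj C H1 x.
  have [eta etav] := tmap_pr_surj u v; have [eta' etaw] := tmap_pr_surj u w.
  rewrite (nabla_xi ux etav) (nabla_xi ux etaw) => /tclass_inj /eqP.
  rewrite -subr_eq0 -mulmxBl -omegaB => /eqP /omega_ell_inj.
  by rewrite tmapB etav etaw => /eqP; rewrite subr_eq0 => /eqP.
Qed.

Lemma nabla_xi_isometry x (v w : tangent x) :
  tmetric (nabla xi v) (nabla xi w) = h_omega C e n v w.
Proof.
have key u : bproj u = x -> tmetric (nabla xi v) (nabla xi w) =
    qform (@phi _ _ _ _ C e n u v) (@phi _ _ _ _ C e n u w).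
  move=> ux; have [eta etav] := tmap_pr_surj u v.
  have [eta' etaw] := tmap_pr_surj u w.
  rewrite (nabla_xi ux etav) (nabla_xi ux etaw) tmetric_class.
  by rewrite -{1}etav -{1}etaw !phiE qform_mod_h.
rewrite /h_omega; case: xgetP => [r _ [u [/key -> ->]] //|].
have [u ux] := bproj_surj C H1 x.
move=> /(_ (qform (@phi _ _ _ _ C e n u v) (@phi _ _ _ _ C e n u w)))[].
by exists u.
Qed.

Lemma nabla_xi_Z x : nabla xi (Z_omega C e n x) = xi x.
Proof.
rewrite /Z_omega; case: xgetP => [v _ [u [ux]]|].
  have [eta etav] := tmap_pr_surj u v.
  rewrite -{1}etav phiE mod_h_radical => etaE.
  by rewrite (nabla_xi ux etav) etaE -ux xiE.
(* A value for [Z_omega] exists: ell is null, hence orthogonal to itself, so some eta has omega eta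
   ell = ell. *)
have [u ux] := bproj_surj C H1 x; have [[ll _] _ _ _ _] := basis.
have [eta /mod_h_radical etaE] := omega_ell_surj u ll.
by move=> /(_ (tmap pr eta))[]; exists u; rewrite phiE.
Qed.

Lemma xi_lightlike : lightlike_section xi.
Proof.
have [[ll l0] _ _ _ _] := basis.
move=> x; have [u <-] := bproj_surj C H1 x; rewrite xiE tmetric_class; split=> //.
(* A zero class would give ell = 0, against the positive last coordinate of a future vector. *)
move=> [u' /tclassP[h Hh [_ h0]]]; move: l0.
by rewrite -(groupH_fix_inv Hh) -h0 mxE ltxx.
Qed.

End CanonicalSection.

End Tractor.

Theorem proposition5p2 (R : realType) (m : nat) (hm : (2 <= m)%N)
    (ell : 'cV[R]_m.+2) (e : 'I_m -> 'cV[R]_m.+2) (n : 'cV[R]_m.+2)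
    (hbasis : adapted_basis ell e n)
    (N : charted 'rV[R]_m.+1) (hN : is_manifold N)
    (hconn : connected [set: N])
    (C : cartan_geometry ell N) :
  exists xi : N -> tractor C,
    [/\ smooth_section xi,
        lightlike_section xi,
        bundle_monomorphism (nabla xi),
        forall (x : N) (v w : tangent x),
          tmetric (nabla xi v) (nabla xi w) = h_omega C e n v w
      & forall x : N, nabla xi (Z_omega C e n x) = xi x].
Proof.
(* The points u x are chosen without any continuity in x; this is harmless because the class
   [u, ell] depends only on the base point. *)
have /choice[u uE] := bproj_surj C (groupH1 ell).
pose xi x : tractor C := tclass (u x) ell.
have xiE v : xi (bproj v) = tclass v ell by exact: tclass_ell.
exists xi; split.
- exact: xi_smooth_section.
- exact: (xi_lightlike hbasis).
- exact: (nabla_xi_mono hN hbasis).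
- exact: (nabla_xi_isometry hN hbasis).
- exact: (nabla_xi_Z hN hbasis).
Qed.
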